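(* Let $n\ge1$ and let $\mathscr A$ be a symmetric orientation of $A_{2n-1}$. Then the convex hull of $\{M_{\mathscr A}(T):T\in\mathcal T^B_{2n+2}\}\subset\mathbb R^{2n}$ is a realization of the cyclohedron $\mathrm{Ass}(B_n)$ (a convex polytope combinatorially equivalent to the $n$-dimensional cyclohedron), and all these points have integer coordinates.
   Context: Set $m=2n$. $A_{m-1}$ is the path with vertices $\tau_1,\dots,\tau_{m-1}$ and edges $\{\tau_i,\tau_{i+1}\}$; an orientation $\mathscr A$ directs each edge. It is symmetric if for every $i\in[2n-2]$ the edges $\{\tau_i,\tau_{i+1}\}$ and $\{\tau_{2n-i-1},\tau_{2n-i}\}$ are oriented in opposite directions (i.e. $\tau_i\to\tau_{i+1}$ iff $\tau_{2n-i}\to\tau_{2n-i-1}$); these correspond bijectively to orientations of the Coxeter graph $B_n$. $i\in\{2,\dots,m-1\}$ is up if $\{\tau_{i-1},\tau_i\}$ is directed from $\tau_i$ to $\tau_{i-1}$, down otherwise; $1,m$ are down. Labelled polygon: in a convex $(m+2)$-gon $P$ label a vertex $0$, then counterclockwise the down elements increasingly, then $m+1$, then the up elements decreasingly. A triangulation $T$ is a set of $m-1$ non-crossing diagonals, viewed as a graph together with the boundary edges; $\{a,b\}\in T$ means it is an edge of this graph; $\mathcal T_{m+2}$ is the set of triangulations. $T$ is centrally symmetric if, viewing the labelled polygon as a regular $(2n+2)$-gon, $T$ is invariant under the central symmetry; $\mathcal T^B_{2n+2}$ is the set of centrally symmetric triangulations. $\mu_i(j)$ ($i\in[m]$, $0\le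 j\le m+1$) is the number of edges of the boundary path of $P$ from $i$ to $j$ using only labels $\le i$ if $j<i$, only labels $\ge i$ if $j\ge i$. $p^T_\ell(i)=\max\{\mu_i(a):0\le a<i,\{a,i\}\in T\}$, $p^T_r(i)=\max\{\mu_i(b):i<b\le m+1,\{i,b\}\in T\}$, $\omega_i=p^T_\ell(i)p^T_r(i)$, $x_i=\omega_i$ ($i$ down) or $m+1-\omega_i$ ($i$ up), $M_{\mathscr A}(T)=(x_1,\dots,x_m)$. The cyclohedron $\mathrm{Ass}(B_n)$ is (up to combinatorial equivalence) the $n$-dimensional simple polytope whose face lattice is isomorphic to the poset of centrally symmetric sets of pairwise non-crossing diagonals of a regular $(2n+2)$-gon, ordered by reverse inclusion (vertices correspond to centrally symmetric triangulations). *)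

(* Defs.v *)
From mathcomp Require Import all_boot all_order all_algebra.
From mathcomp Require Import boolp classical_sets reals convex.
Set Implicit Arguments.
Unset Strict Implicit.
Unset Printing Implicit Defensive.
Import Order.TTheory GRing.Theory Num.Theory.

Local Open Scope ring_scope.

(* The vertices of a convex [m + 2]-gon are its positions [0, ..., m + 1] in
counterclockwise order, in the type 'I_m.+2, whose addition is addition
modulo [m + 2].  A diagonal is a set of two vertices. *)

Definition boundary_edge (m : nat) (u v : 'I_m.+2) : bool :=
  (v == u + 1) || (u == v + 1).

Definition is_diagonal (m : nat) (d : {set 'I_m.+2}) : bool :=
  [exists u, exists v, [&& d == [set u; v], u != v & ~~ boundary_edge u v]].

(* Two diagonals of a convex polygon meet in their interiors iff their end
   points alternate along the boundary. *)
Definition crossing (m : nat) (d e : {set 'I_m.+2}) : bool :=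
  [exists a, exists b, exists c, exists c',
    [&& ((d == [set a; b]) && (e == [set c; c']))
        || ((e == [set a; b]) && (d == [set c; c'])),
        (a < c)%N, (c < b)%N & (b < c')%N]].

Definition noncrossing (m : nat) (D : {set {set 'I_m.+2}}) : bool :=
  [forall d in D, is_diagonal d] &&
  [forall d in D, forall e in D, ~~ crossing d e].

Definition is_triangulation (m : nat) (T : {set {set 'I_m.+2}}) : bool :=
  noncrossing T && (#|T| == m.-1).

(* Adjacency in the graph formed by [T] and the boundary of the polygon. *)
Definition graph_edge (m : nat) (T : {set {set 'I_m.+2}}) (u v : 'I_m.+2) :
  bool := boundary_edge u v || ([set u; v] \in T).

Definition antipode (n : nat) (v : 'I_(2 * n).+2) : 'I_(2 * n).+2 :=
  v + n.+1%:R.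

Definition centrally_symmetric (n : nat) (D : {set {set 'I_(2 * n).+2}}) :
  bool := [set (@antipode n) @: (d : {set _}) | d in D]%SET == D.

Definition is_cs_triangulation (n : nat) (T : {set {set 'I_(2 * n).+2}}) :
  bool := is_triangulation T && centrally_symmetric T.

(* [A i j] means that there is an arc from [tau_i] to [tau_j]. *)
Definition path_edge (k i j : nat) : bool :=
  [&& (0 < i <= k)%N, (0 < j <= k)%N & (j == i.+1) || (i == j.+1)].

Definition is_orientation (k : nat) (A : rel nat) : Prop :=
  (forall i j, A i j -> path_edge k i j) /\
  (forall i j, path_edge k i j -> A i j = ~~ A j i).

Definition symmetric_orientation (n : nat) (A : rel nat) : Prop :=
  forall i : nat, (1 <= i <= 2 * n - 2)%N ->
    A i i.+1 = A (2 * n - i)%N (2 * n - i - 1)%N.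

Definition up (m : nat) (A : rel nat) (i : nat) : bool :=
  (2 <= i <= m.-1)%N && A i i.-1.

(* The labels of the polygon in counterclockwise order. *)
Definition labels (m : nat) (A : rel nat) : seq nat :=
  0%N :: [seq i <- iota 1 m | ~~ up m A i]
    ++ m.+1 :: rev [seq i <- iota 1 m | up m A i].

Definition label (m : nat) (A : rel nat) (v : 'I_m.+2) : nat :=
  nth 0%N (labels m A) v.

Definition vertex (m : nat) (A : rel nat) (a : nat) : 'I_m.+2 :=
  inord (index a (labels m A)).

Definition walk (m : nat) (ccw : bool) (u : 'I_m.+2) (k : nat) : 'I_m.+2 :=
  if ccw then u + k%:R else u - k%:R.

(* The least [k] such that a boundary walk of [k] steps, in one of the two
   directions, leads from the vertex labelled [i] to the one labelled [j]
   through allowed labels only. *)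
Definition mu (m : nat) (A : rel nat) (i j : nat) : nat :=
  let allowed a := if (j < i)%N then (a <= i)%N else (i <= a)%N in
  find (fun k => [exists ccw : bool,
      (walk ccw (vertex m A i) k == vertex m A j)
      && all (fun t => allowed (label A (walk ccw (vertex m A i) t)))
             (iota 0 k.+1)])
    (iota 0 m.+2).

Definition p_l (m : nat) (A : rel nat) (T : {set {set 'I_m.+2}}) (i : nat) :
    nat :=
  \max_(a < m.+2 | (a < i)%N && graph_edge T (vertex m A a) (vertex m A i))
    mu m A i a.

Definition p_r (m : nat) (A : rel nat) (T : {set {set 'I_m.+2}}) (i : nat) :
    nat :=
  \max_(b < m.+2 | (i < b)%N && graph_edge T (vertex m A i) (vertex m A b))
    mu m A i b.

Definition omega (m : nat) (A : rel nat) (T : {set {set 'I_m.+2}}) (i : nat) :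
  nat := (p_l A T i * p_r A T i)%N.

(* The coordinate of index [i : 'I_m] is the one of the label [i + 1]. *)
Definition Mpoint (R : realType) (m : nat) (A : rel nat)
    (T : {set {set 'I_m.+2}}) : 'rV[R]_m :=
  \row_(i < m) (if up m A i.+1 then m.+1%:R - (omega A T i.+1)%:R
                else (omega A T i.+1)%:R).

Local Open Scope classical_set_scope.

Definition conv_hull (R : realType) (m : nat) (X : set 'rV[R]_m) :
  set 'rV[R]_m := smallest (@convex_set R 'rV[R]_m) X.

Definition is_polytope (R : realType) (m : nat) (P : set 'rV[R]_m) : Prop :=
  exists s : seq 'rV[R]_m, P = conv_hull [set` s].

(* The linear inequality [c . x <= b] is valid on [P]; [c = 0] yields the empty
   face and [P] itself. *)
Definition is_face (R : realType) (m : nat) (P F : set 'rV[R]_m) : Prop :=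
  exists (c : 'rV[R]_m) (b : R),
    (forall x, P x -> (c *m x^T) 0 0 <= b) /\
    F = P `&` [set x | (c *m x^T) 0 0 = b].

(* The face lattice of the cyclohedron Ass(B_n): the centrally symmetric sets of
   pairwise non-crossing diagonals of the regular [2n + 2]-gon under reverse
   inclusion, with a least element [None] adjoined for the empty face. *)
Definition cyclohedron_face (n : nat)
    (x : option {set {set 'I_(2 * n).+2}}) : bool :=
  if x is Some D then noncrossing D && centrally_symmetric D else true.

Definition cyclohedron_le (n : nat)
    (x y : option {set {set 'I_(2 * n).+2}}) : bool :=
  match x, y with
  | None, _ => true
  | Some _, None => false
  | Some D, Some E => E \subset D
  end.

Definition realizes_cyclohedron (R : realType) (n m : nat)
    (P : set 'rV[R]_m) : Prop :=
  is_polytope P /\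
  exists phi : option {set {set 'I_(2 * n).+2}} -> set 'rV[R]_m,
    [/\ forall x, cyclohedron_face x -> is_face P (phi x),
        forall F, is_face P F -> exists2 x, cyclohedron_face x & phi x = F
      & forall x y, cyclohedron_face x -> cyclohedron_face y ->
          cyclohedron_le x y <-> phi x `<=` phi y].

(* Main.v *)
(** The functional [edge_slack x u v] is the defining inequality of the
facet of the generalised associahedron that belongs to the diagonal [uv]: the
sum of the coordinates whose labels lie below [uv], minus its minimum over the
permutahedron.  It vanishes on boundary edges as soon as the total sum of [x]
is right.

Two facts drive the proof.  First, the labels below [ab] split into a
contribution of [a] and one of [b], so that on the four sides and diagonals of
a quadrilateral the linear parts cancel, and convexity of the binomial
coefficient shows that, at every point [x], the slacks of two crossing
diagonals have a larger sum than those of some two opposite sides.  Hence a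
point at which the slacks of all diagonals of a triangulation [T] vanish has
positive slack at every other diagonal, by induction on the number of
crossings with [T].  Second, every label [i] is the middle one of a triangle of [T], and the coordinate [x_i] is a
signed sum of the slacks of its three sides plus the [i]-th coordinate of
[M(T)].  So the slacks of [T] determine [x]; there are as many of them as
needed, the common zero exists, and it is [M(T)].

For symmetric [T], uniqueness shows that [M(T)] is invariant under
[x_i |-> m + 1 - x_(m+1-i)], which exchanges the slacks of a diagonal and
of its antipode.  A linear functional that is maximal at [M(T)] is a constant
minus a combination of the slacks of [T]; flipping a symmetric pair of
diagonals shows that its symmetrised coefficients are nonnegative, and the
face it defines is cut out by the diagonals with positive coefficient. *)
Require Import Defs.
From mathcomp Require Import all_boot all_order all_algebra.
From mathcomp Require Import boolp classical_sets reals interval_inference convex.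
From mathcomp Require Import zify ring lra.
Import Order.TTheory GRing.Theory Num.Theory.
Set Implicit Arguments.
Unset Strict Implicit.
Unset Printing Implicit Defensive.

Local Open Scope ring_scope.
Local Open Scope nat_scope.

(** * Noncrossing sets of diagonals of a polygon *)

Definition cyc (p c q : nat) : bool :=
  [|| p < c < q, c < q < p | q < p < c].

Definition alternate (u v w t : nat) : bool :=
  cyc u w v && cyc v t u || cyc u t v && cyc v w u.

Lemma alternateCr u v w t : alternate u v w t = alternate u v t w.
Proof. by rewrite /alternate orbC. Qed.

Lemma alternateI u v w t : cyc u w v -> cyc v t u -> alternate u v w t.
Proof. by rewrite /alternate => -> ->. Qed.

Lemma alternate_ind (P : nat -> nat -> Prop) u v :
  (forall w t, P w t -> P t w) ->
  (forall w t, cyc u w v -> cyc v t u -> P w t) ->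
  forall w t, alternate u v w t -> P w t.
Proof.
by move=> sP H w t /orP[]/andP[h1 h2]; [exact: H | apply: sP; exact: H].
Qed.

Lemma alternate_fan p c c' w t : cyc p c c' -> alternate c c' w t ->
  [\/ w = p /\ cyc c t c', t = p /\ cyc c w c' |
    alternate p c w t || alternate p c' w t].
Proof.
move=> h; move: w t; apply: alternate_ind => w t.
  rewrite (alternateCr p c) (alternateCr p c').
  by case; [constructor 2 | constructor 1 | constructor 3].
move=> h1 h2.
have [[->]|[h3|h3]] : t = p \/ (cyc c' t p \/ cyc p t c) by
  move: h h1 h2; rewrite /cyc; lia.
- by constructor 2.
- constructor 3; apply/orP; right.
  by apply: alternateI => //; move: h h1; rewrite /cyc; lia.
constructor 3; apply/orP; left; rewrite alternateCr.
by apply: alternateI => //; move: h h1; rewrite /cyc; lia.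
Qed.

Lemma alternate_quad p c q c' w t : cyc p c q -> cyc q c' p ->
  alternate c c' w t ->
  [|| alternate p c w t, alternate c q w t, alternate q c' w t
    | alternate c' p w t] \/ (w = q /\ t = p \/ w = p /\ t = q).
Proof.
move=> h h'; move: w t; apply: alternate_ind => w t.
  rewrite (alternateCr p c) (alternateCr c q) (alternateCr q c') (alternateCr c' p).
  by case=> [->|[][-> ->]]; [left|right; right|right; left].
move=> h1 h2.
have [[e1 e2]|[h3|[h3|[h3|h3]]]] : (w = q /\ t = p) \/
    (cyc c w q \/ (cyc q w c' \/ (cyc c' t p \/ cyc p t c))) by
  move: h h' h1 h2; rewrite /cyc; lia.
- by right; left.
- left; apply/or4P; constructor 2.
  by apply: alternateI => //; move: h h' h2; rewrite /cyc; lia.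
- left; apply/or4P; constructor 3.
  by apply: alternateI => //; move: h h' h2; rewrite /cyc; lia.
- left; apply/or4P; constructor 4; rewrite alternateCr.
  by apply: alternateI => //; move: h h' h1; rewrite /cyc; lia.
left; apply/or4P; constructor 1; rewrite alternateCr.
by apply: alternateI => //; move: h h' h1; rewrite /cyc; lia.
Qed.

Lemma alternateCl u v w t : alternate u v w t = alternate v u w t.
Proof. by rewrite /alternate orbC andbC [X in _ || X]andbC. Qed.

Lemma alternate_side u w v t p q : cyc u w v -> cyc v t u ->
  alternate u w p q -> alternate u v p q || alternate w t p q.
Proof.
move=> h h'; move: p q; apply: alternate_ind => p q.
  by rewrite (alternateCr u v) (alternateCr w t).
move=> h1 h2.
have [h3|h3] : cyc v q u \/ cyc w q t by move: h h' h1 h2; rewrite /cyc; lia.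
  by rewrite alternateI //; move: h h1; rewrite /cyc; lia.
rewrite orbC alternateCr alternateI //.
by move: h h' h1; rewrite /cyc; lia.
Qed.

Lemma alternate_share p q t : alternate p q p t = false.
Proof. by rewrite /alternate /cyc; lia. Qed.

Lemma cyc_neq p c q : cyc p c q -> [/\ p != c, c != q & p != q].
Proof. by rewrite /cyc; split; lia. Qed.

Lemma alternate_sides u v w t p q : cyc u w v -> cyc v t u ->
  [|| alternate u w p q, alternate v t p q, alternate u t p q
    | alternate v w p q] -> alternate u v p q || alternate w t p q.
Proof.
move=> h1 h2.
have h3 : cyc t u w by move: h1 h2; rewrite /cyc; lia.
have h4 : cyc w v t by move: h1 h2; rewrite /cyc; lia.
case/or4P=> h.
- exact: alternate_side h.
- by rewrite alternateCl (alternateCl w); apply: alternate_side h.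
- by rewrite orbC (alternateCl w); apply: (alternate_side h3 h4); rewrite alternateCl.
- by rewrite orbC (alternateCl u); apply: (alternate_side h4 h3); rewrite alternateCl.
Qed.

Lemma set2_inj (I : finType) (a b c d : I) :
  [set a; b] = [set c; d] -> a = c /\ b = d \/ a = d /\ b = c.
Proof.
move=> E.
have: a \in [set c; d] by rewrite -E set21.
have: b \in [set c; d] by rewrite -E set22.
have: c \in [set a; b] by rewrite E set21.
have: d \in [set a; b] by rewrite E set22.
rewrite !in_set2 => /orP[]/eqP ? /orP[]/eqP ? /orP[]/eqP ? /orP[]/eqP ?;
  subst; by [left | right].
Qed.

Section Polygon.
Variable m : nat.
Implicit Types (u v w t p q c : 'I_m.+2) (d e : {set 'I_m.+2})
  (T D : {set {set 'I_m.+2}}).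

Lemma val_addn u k : k < m.+2 ->
  (u + k%:R)%R = (if u + k < m.+2 then u + k else u + k - m.+2) :> nat.
Proof.
move=> k_lt; rewrite Zp_nat /= modnDmr; have := ltn_ord u.
case: (ltnP (u + k)) => [h _|h u_lt]; first by rewrite modn_small.
by rewrite -{1}(subnK h) modnDr modn_small; lia.
Qed.

Lemma val_subn u k : k < m.+2 ->
  (u - k%:R)%R = (if k <= u then u - k else u + m.+2 - k) :> nat.
Proof.
move=> k_lt; rewrite Zp_nat /= modnDmr (modn_small k_lt).
have u_lt := ltn_ord u; case: (leqP k u) => h; last by rewrite modn_small; lia.
have -> : u + (m.+2 - k) = u - k + m.+2 by lia.
by rewrite modnDr modn_small; lia.
Qed.

Lemma boundary_edgeE u v : boundary_edge u v =
  [|| u.+1 == v :> nat, v.+1 == u :> nat, (u == 0 :> nat) && (v == m.+1 :> nat)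
    | (v == 0 :> nat) && (u == m.+1 :> nat)].
Proof.
have succE p : val (p + 1)%R = (if p.+1 < m.+2 then p.+1 else 0).
  have := ltn_ord p; rewrite [val _](@val_addn p 1 isT) addn1; case: (ltnP p.+1); lia.
rewrite /boundary_edge -!val_eqE !succE.
have := ltn_ord u; have := ltn_ord v.
by case: (ltnP u.+1); case: (ltnP v.+1); rewrite /=; lia.
Qed.

Lemma boundary_edgeC u v : boundary_edge u v = boundary_edge v u.
Proof. by rewrite /boundary_edge orbC. Qed.

Lemma graph_edgeC T u v : graph_edge T u v = graph_edge T v u.
Proof. by rewrite /graph_edge boundary_edgeC finset.setUC. Qed.

Lemma is_diagonalP u v :
  reflect (u != v /\ ~~ boundary_edge u v) (is_diagonal [set u; v]).
Proof.
apply: (iffP existsP) => [[p /existsP[q /and3P[/eqP E pq nb]]]|[uv nb]].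
  by case: (set2_inj E) => -[-> ->] //; rewrite eq_sym boundary_edgeC.
by exists u; apply/existsP; exists v; rewrite eqxx uv nb.
Qed.

Lemma crossingE u v w t :
  crossing [set u; v] [set w; t] = alternate u v w t.
Proof.
apply/existsP/idP.
  move=> [a /existsP[b /existsP[c /existsP[c' /and4P[]]]]].
  rewrite /alternate /cyc.
  case/orP=> /andP[/eqP E1 /eqP E2];
    case: (set2_inj E1) => -[-> ->]; case: (set2_inj E2) => -[-> ->]; lia.
have H a b c c' : [set u; v] = [set a; b] /\ [set w; t] = [set c; c'] \/
    [set u; v] = [set c; c'] /\ [set w; t] = [set a; b] ->
    a < c -> c < b -> b < c' ->
    exists x : 'I_m.+2, [exists b, exists c, exists c',
      [&& ([set u; v] == [set x; b]) && ([set w; t] == [set c; c'])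
        || ([set w; t] == [set x; b]) && ([set u; v] == [set c; c']),
        (x < c), (c < b) & (b < c')]].
  move=> h ac cb bc; exists a; apply/existsP; exists b.
  apply/existsP; exists c; apply/existsP; exists c'.
  rewrite ac cb bc !andbT.
  by case: h => -[-> ->]; rewrite !eqxx ?orbT.
have ut := finset.setUC [set u] [set v]; have wt := finset.setUC [set w] [set t].
move=> X.
have [uv|uv] := leqP u v; have [wt'|wt'] := leqP w t;
  have [uw|uw] := leqP (minn u v) (minn w t).
- by apply: (H u v w t); move: X; rewrite /alternate /cyc; [left|lia..].
- by apply: (H w t u v); move: X; rewrite /alternate /cyc; [right|lia..].
- by apply: (H u v t w); move: X; rewrite /alternate /cyc ?ut ?wt; [left|lia..].
- by apply: (H t w u v); move: X; rewrite /alternate /cyc ?ut ?wt; [right|lia..].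
- by apply: (H v u w t); move: X; rewrite /alternate /cyc ?ut ?wt; [left|lia..].
- by apply: (H w t v u); move: X; rewrite /alternate /cyc ?ut ?wt; [right|lia..].
- by apply: (H v u t w); move: X; rewrite /alternate /cyc ?ut ?wt; [left|lia..].
- by apply: (H t w v u); move: X; rewrite /alternate /cyc ?ut ?wt; [right|lia..].
Qed.

Definition saturated T : Prop := noncrossing T /\
  forall d, is_diagonal d -> (forall e, e \in T -> ~~ crossing d e) -> d \in T.

Lemma noncrossing_diagonal T d : noncrossing T -> d \in T -> is_diagonal d.
Proof. by move=> /andP[/forall_inP H _] /H. Qed.

Lemma noncrossing_cross T d e :
  noncrossing T -> d \in T -> e \in T -> ~~ crossing d e.
Proof. by move=> /andP[_ /forall_inP H] /H /forall_inP; apply. Qed.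

Lemma diagonalE d : is_diagonal d -> exists u v, d = [set u; v] /\ u != v.
Proof.
by case/existsP=> u /existsP[v /and3P[/eqP -> uv _]]; exists u, v.
Qed.

Lemma edge_alternate T u v w t : noncrossing T ->
  graph_edge T u v -> [set w; t] \in T -> ~~ alternate u v w t.
Proof.
move=> nT /orP[bnd|uvT] wtT; last by rewrite -crossingE (noncrossing_cross nT).
move: bnd; rewrite boundary_edgeE /alternate /cyc.
have := ltn_ord u; have := ltn_ord v; have := ltn_ord w; have := ltn_ord t; lia.
Qed.

(* A diagonal crossing [c c'] either ends at [p] between [c] and [c'] or crosses
one of [p c] and [p c']. *)
Lemma fan T p c c' : saturated T -> graph_edge T p c -> graph_edge T p c' ->
  cyc p c c' -> (forall w, cyc c w c' -> ~~ graph_edge T p w) ->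
  graph_edge T c c'.
Proof.
move=> [nT sT] pc pc' cycp nbr; apply/orP.
have [//|nb] := boolP (boundary_edge c c'); [by left | right].
apply: sT => [|e eT].
  apply/is_diagonalP; split=> //; apply: contraTneq cycp => ->.
  by rewrite /cyc; lia.
have /diagonalE[w [t [Ee wt]]] := noncrossing_diagonal nT eT.
rewrite Ee in eT *; rewrite crossingE; apply/negP => X.
have := edge_alternate nT pc eT; have := edge_alternate nT pc' eT.
move=> /negP h1 /negP h2.
case: (alternate_fan cycp X) => [[/val_inj Ew /nbr/negP]|[/val_inj Et /nbr/negP]|].
- by apply; rewrite /graph_edge -Ew eT orbT.
- by apply; rewrite /graph_edge -Et finset.setUC eT orbT.
by case/orP.
Qed.

Definition arc (p c : nat) : nat := if p <= c then c - p else c + m.+2 - p.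

Lemma side_triangle T p q : saturated T -> [set p; q] \in T ->
  exists c, [/\ cyc p c q, graph_edge T p c & graph_edge T c q].
Proof.
move=> sT pqT.
have /is_diagonalP[pq nb] := noncrossing_diagonal sT.1 pqT.
pose s := (p + 1)%R.
have sE : (val s = p.+1 /\ p.+1 < m.+2) \/ (val s = 0 /\ p = m.+1 :> nat).
  rewrite [val s](@val_addn p 1 isT) addn1; have := ltn_ord p.
  by case: (ltnP p.+1); lia.
have pqn : val p <> q by move/val_inj/eqP; apply/negP.
have cycs : cyc p s q && graph_edge T p s.
  rewrite /graph_edge /boundary_edge eqxx andbT.
  move: nb; rewrite boundary_edgeE /cyc; have := ltn_ord q; have := ltn_ord p.
  rewrite /= in pqn sE *; lia.
case: (@arg_maxnP _ s (fun c => cyc p c q && graph_edge T p c) (arc p) cycs).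
move=> c /andP[cycc pc] cmax; exists c; split=> //.
apply: (fan sT pc) => //; first by rewrite /graph_edge pqT orbT.
move=> w cycw; apply/negP => pw.
have: cyc p w q by move: cycc cycw; rewrite /cyc; lia.
move=> cycw'; have := cmax w; rewrite cycw' pw => /(_ isT).
move: cycc cycw cycw' (ltn_ord w) (ltn_ord c); rewrite /cyc /arc.
by case: (leqP p w); case: (leqP p c); lia.
Qed.

Lemma flip T d : saturated T -> d \in T ->
  exists e, [/\ is_diagonal e, crossing e d &
    forall d', d' \in T -> d' != d -> ~~ crossing e d'].
Proof.
move=> sT dT; have nT := sT.1.
have /diagonalE[p [q [Ed pq]]] := noncrossing_diagonal nT dT.
subst d.
have [c [cycc pc cq]] := side_triangle sT dT.
have qpT : [set q; p] \in T by rewrite finset.setUC.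
have [c' [cycc' qc' c'p]] := side_triangle sT qpT.
exists [set c; c']; split.
- apply/is_diagonalP; rewrite boundary_edgeE -val_eqE /=.
  move: cycc cycc' (ltn_ord c) (ltn_ord c') (ltn_ord p) (ltn_ord q).
  rewrite /cyc; lia.
- by rewrite crossingE; move: cycc cycc'; rewrite /alternate /cyc; lia.
move=> d' d'T; have /diagonalE[w [t [Ed' wt]]] := noncrossing_diagonal nT d'T.
subst d'; apply: contra; rewrite crossingE => X.
have := edge_alternate nT pc d'T; have := edge_alternate nT cq d'T.
have := edge_alternate nT qc' d'T; have := edge_alternate nT c'p d'T.
move=> /negPf h1 /negPf h2 /negPf h3 /negPf h4.
have := alternate_quad cycc cycc' X; rewrite h1 h2 h3 h4 /=.
case=> // -[] [/val_inj -> /val_inj ->] //.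
by rewrite finset.setUC.
Qed.

Lemma crossingC d e : crossing d e = crossing e d.
Proof.
rewrite /crossing; do 4!apply: eq_existsb => ?.
by rewrite orbC.
Qed.

Lemma crossingxx d : is_diagonal d -> crossing d d = false.
Proof.
case/diagonalE=> u [v [-> _]].
by rewrite crossingE /alternate /cyc; lia.
Qed.

Lemma noncrossing_setU1 T d : noncrossing T -> is_diagonal d ->
  (forall e, e \in T -> ~~ crossing d e) -> noncrossing (d |: T).
Proof.
move=> nT dd dT; apply/andP; split.
  apply/forall_inP=> e /setU1P[-> //|]; exact: noncrossing_diagonal.
apply/forall_inP=> e /setU1P[->|eT]; apply/forall_inP=> f /setU1P[->|fT].
- by rewrite crossingxx.
- exact: dT.
- by rewrite crossingC dT.
- exact: noncrossing_cross eT fT.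
Qed.

Definition chords D (p q : nat) : {set 'I_m.+2 * 'I_m.+2} :=
  [set w : 'I_m.+2 * 'I_m.+2 | [&& p <= w.1, w.1 < w.2, w.2 <= q & [set w.1; w.2] \in D]].

(* [r] is the last vertex before [q] that is joined to [p]. *)
Lemma chords_split D (p q : 'I_m.+2) : noncrossing D -> p.+1 < q ->
  exists r : 'I_m.+2,
    p < r < q /\ chords D p q :\ (p, q) \subset chords D p r :|: chords D r q.
Proof.
move=> nD pq.
pose P r := (p < r < q) && ((r == p.+1) || ([set p; inord r] \in D)).
have exP : exists r, P r by exists p.+1; rewrite /P pq eqxx; lia.
have leP' r : P r -> r <= q by case/andP=> /andP[_ /ltnW].
have [r /andP[/andP[pr rq] Pr] rmax] := ex_maxnP exP leP'.
have r_lt : r < m.+2 := ltn_trans rq (ltn_ord q).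
exists (Ordinal r_lt); split; first by rewrite pr.
apply/fintype.subsetP => -[u v]; rewrite !inE /= xpair_eqE.
move=> /andP[uvpq /and4P[pu uv vq uvD]].
rewrite uvD !andbT uv /=.
have [up|up] := eqVneq u p.
  have vq' : v != q by move: uvpq; rewrite up eqxx.
  suff: v <= r by rewrite pu => ->.
  apply: rmax; rewrite /P inord_val -{3}up uvD orbT andbT -{1}up uv /=.
  by move: vq vq'; rewrite -val_eqE /=; lia.
have pu' : p < u by move: up pu; rewrite -val_eqE /=; lia.
have [ru|ur] := leqP r u; first by rewrite vq orbT.
suff vr : v <= r by rewrite pu vr.
rewrite leqNgt.
case/orP: Pr => [/eqP rE|prD]; first by lia.
apply/negP=> rv; have := noncrossing_cross nD prD uvD.
rewrite crossingE /alternate /cyc inordK //.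
by have := ltn_ord v; lia.
Qed.

Lemma chords_card D (p q : 'I_m.+2) : noncrossing D -> p < q ->
  #|chords D p q| <= q - p - 1.
Proof.
move=> nD; have [k] := ubnP (q - p); elim: k p q => // k IHk p q lek pq.
have [pq'|pq'] := leqP q p.+1.
  rewrite (_ : chords D p q = finset.set0) ?cards0 //.
  apply/setP=> -[u v]; rewrite !inE /=; apply/negP => /and4P[pu uv vq uvD].
  have /is_diagonalP[_ /negP[]] := noncrossing_diagonal nD uvD.
  by rewrite boundary_edgeE; lia.
have [r [/andP[pr rq] /subset_leq_card]] := chords_split nD pq'.
have rp_lt : r - p < k by lia.
have qr_lt : q - r < k by lia.
have := IHk p r rp_lt pr; have := IHk r q qr_lt rq.
have := cardsD1 (p, q) (chords D p q).
have := leq_b1 ((p, q) \in chords D p q).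
have := (leq_card_setU (chords D p r) (chords D r q)).1.
move: #|chords D p r :|: chords D r q| #|chords D p r| #|chords D r q|.
move: #|chords D p q| #|chords D p q :\ (p,q)| => *; lia.
Qed.

Lemma noncrossing_card D : noncrossing D -> #|D| <= m.-1.
Proof.
move=> nD.
have: #|D| <= #|chords D 0 m.+1|.
  apply: leq_trans (leq_imset_card (fun w : 'I_m.+2 * 'I_m.+2 => [set w.1; w.2]) _).
  apply/subset_leq_card/fintype.subsetP=> d dD.
  have /diagonalE[u [v [Ed uv]]] := noncrossing_diagonal nD dD.
  move: uv; rewrite -val_eqE /= neq_ltn => /orP[] uv.
    by apply/imsetP; exists (u, v); rewrite ?inE ?uv -?Ed ?dD //= -ltnS ltn_ord.
  apply/imsetP; exists (v, u) => /=; last by rewrite Ed finset.setUC.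
  by rewrite inE /= uv finset.setUC -Ed dD -ltnS ltn_ord.
have [m0|m0] := posnP m.
  move=> h; apply: leq_trans h (leq_trans (@chords_card D ord0 ord_max nD isT) _).
  by rewrite /=; lia.
have [|r [/andP[r0 rm] /subset_leq_card h]] := @chords_split D ord0 ord_max nD.
  by rewrite /=; lia.
have nin : (ord0, ord_max : 'I_m.+2) \notin chords D 0 m.+1.
  rewrite inE; apply/negP => /and4P[_ _ _ /(noncrossing_diagonal nD)].
  by case/is_diagonalP=> _ /negP[]; rewrite boundary_edgeE /=; lia.
have := @chords_card D ord0 r nD r0; have := @chords_card D r ord_max nD rm.
have := (leq_card_setU (chords D 0 r) (chords D r m.+1)).1.
rewrite (cardsD1 (ord0, ord_max : 'I_m.+2) (chords D 0 m.+1)).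
rewrite (negPf nin) add0n => c1 c2 c3 h5.
apply: leq_trans h5 (leq_trans h (leq_trans c1 _)).
by apply: leq_trans (leq_add c3 c2) _; move: r0 rm => /=; lia.
Qed.

Lemma is_triangulation_saturated T : is_triangulation T -> saturated T.
Proof.
case/andP=> nT /eqP cT; split=> // d dd dT; apply/negPn/negP=> dnT.
have := noncrossing_card (noncrossing_setU1 nT dd dT).
rewrite cardsU1 dnT cT add1n ltnn //.
Qed.
End Polygon.

Section CentralSymmetry.
Variable n : nat.
Notation N := (2 * n).+2.
Implicit Types (u v w t p q c : 'I_N) (d e : {set 'I_N})
  (T D : {set {set 'I_N}}).
Notation ap := (@antipode n).
Notation aps d := (ap @: (d : {set 'I_N})).

Lemma val_antipode v :
  ap v = (if v < n.+1 then v + n.+1 else v - n.+1) :> nat.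
Proof.
have := ltn_ord v; rewrite [LHS]val_addn; last by lia.
by case: ifP; case: ifP; lia.
Qed.

Lemma antipodeK : involutive ap.
Proof.
move=> v; apply/ord_inj; have := ltn_ord v.
by rewrite !val_antipode; case: (ltnP v n.+1); case: ifP; lia.
Qed.

Lemma cyc_antipode p c q : cyc (ap p) (ap c) (ap q) = cyc p c q.
Proof.
rewrite /cyc !val_antipode.
have := ltn_ord p; have := ltn_ord q; have := ltn_ord c.
case: (ltnP p n.+1); case: (ltnP q n.+1); case: (ltnP c n.+1); lia.
Qed.

Lemma alternate_antipode u v w t :
  alternate (ap u) (ap v) (ap w) (ap t) = alternate u v w t.
Proof. by rewrite /alternate !cyc_antipode. Qed.

Lemma alternate_self_antipode u v : alternate u v (ap u) (ap v) = false.
Proof.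
rewrite /alternate /cyc !val_antipode.
have := ltn_ord u; have := ltn_ord v.
case: (ltnP u n.+1); case: (ltnP v n.+1); lia.
Qed.

Lemma imset2_antipode u v : aps [set u; v] = [set ap u; ap v].
Proof. by rewrite imsetU1 imset_set1. Qed.

Lemma antipode_setK : involutive (fun d => aps d).
Proof.
by move=> d; rewrite -imset_comp (eq_imset _ antipodeK) imset_id.
Qed.

Lemma is_diagonal_antipode d : is_diagonal d -> is_diagonal (aps d).
Proof.
move=> dd; have [u [v [Ed uv]]] := diagonalE dd.
move: dd; rewrite Ed imset2_antipode => /is_diagonalP[_ nb].
apply/is_diagonalP; rewrite (inj_eq (inv_inj antipodeK)); split=> //.
move: nb; rewrite !boundary_edgeE !val_antipode.
have := ltn_ord u; have := ltn_ord v.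
case: (ltnP u n.+1); case: (ltnP v n.+1); lia.
Qed.

Lemma crossing_antipode d e : is_diagonal d -> is_diagonal e ->
  crossing (aps d) (aps e) = crossing d e.
Proof.
move=> /diagonalE[u [v [-> _]]] /diagonalE[w [t [-> _]]].
by rewrite !imset2_antipode !crossingE alternate_antipode.
Qed.

Lemma crossing_self_antipode d : is_diagonal d -> ~~ crossing d (aps d).
Proof.
move=> /diagonalE[u [v [-> _]]].
by rewrite imset2_antipode crossingE alternate_self_antipode.
Qed.

Lemma centrally_symmetricP D :
  reflect (forall d, d \in D -> aps d \in D) (centrally_symmetric D).
Proof.
apply: (iffP eqP) => [E d dD|H]; first by rewrite -E; apply: imset_f.
apply/setP=> d; apply/imsetP/idP => [[e eD ->]|dD]; first exact: H.
by exists (aps d); [exact: H | rewrite antipode_setK].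
Qed.

Lemma cs_extend D : noncrossing D -> centrally_symmetric D ->
  exists T, [/\ D \subset T, saturated T & centrally_symmetric T].
Proof.
move=> nD cD; have PD : noncrossing D && centrally_symmetric D by rewrite nD.
have [T /maxsetP[/andP[nT cT] Tmax] DT] :=
  maxset_exists (P := fun T => noncrossing T && centrally_symmetric T) PD.
exists T; split=> //; split=> // d dd dT.
have /centrally_symmetricP sT := cT.
have dd' := is_diagonal_antipode dd.
have dT' e : e \in T -> ~~ crossing (aps d) e.
  move=> eT; rewrite -(antipode_setK e) crossing_antipode ?dT ?sT //.
  exact: is_diagonal_antipode (noncrossing_diagonal nT eT).
suff <- : d |: (aps d |: T) = T by rewrite setU11.
apply: Tmax; last by apply/fintype.subsetP=> e eT; rewrite !inE eT !orbT.
apply/andP; split.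
  apply: noncrossing_setU1 => // [|e /setU1P[->|/dT //]].
    exact: noncrossing_setU1.
  exact: crossing_self_antipode.
apply/centrally_symmetricP => e /setU1P[->|/setU1P[->|/sT eT]].
- by rewrite !inE eqxx orbT.
- by rewrite antipode_setK setU11.
- by rewrite !inE eT !orbT.
Qed.

Lemma cs_flip T d : saturated T -> centrally_symmetric T -> d \in T ->
  exists T', [/\ saturated T', centrally_symmetric T', d \notin T' &
    forall e, e \in T -> e != d -> e != aps d -> e \in T'].
Proof.
move=> sT cT dT; have nT := sT.1; have /centrally_symmetricP csT := cT.
have dd := noncrossing_diagonal nT dT.
have [e [de ed eT]] := flip sT dT.
pose D := T :\ d :\ aps d.
have DT f : f \in D -> [/\ f != aps d, f != d & f \in T].
  by rewrite !inE => /and3P.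
have csD f : f \in D -> aps f \in D.
  case/DT=> fd fd' fT; rewrite !inE csT // andbT.
  rewrite (inj_eq (inv_inj antipode_setK)) fd' /=.
  by apply: contraNneq fd => <-; rewrite antipode_setK.
have nD : noncrossing D.
  apply/andP; split; apply/forall_inP=> f /DT[_ _ fT].
    exact: noncrossing_diagonal fT.
  by apply/forall_inP=> g /DT[_ _ gT]; exact: noncrossing_cross gT.
have eD f : f \in D -> ~~ crossing e f by case/DT=> *; apply: eT.
have eD' f : f \in D -> ~~ crossing (aps e) f.
  move=> fD; have [_ _ fT] := DT _ fD.
  rewrite -(antipode_setK f) crossing_antipode ?eD ?csD //.
  exact: is_diagonal_antipode (noncrossing_diagonal nT fT).
have [] := @cs_extend (e |: (aps e |: D)).
- apply: noncrossing_setU1 => // [|f /setU1P[->|/eD //]].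
    by apply: noncrossing_setU1 => //; apply: is_diagonal_antipode.
  exact: crossing_self_antipode.
- apply/centrally_symmetricP => f /setU1P[->|/setU1P[->|/csD fD]].
  + by rewrite !inE eqxx orbT.
  + by rewrite antipode_setK setU11.
  + by move: fD; rewrite !inE => ->; rewrite !orbT.
move=> T' [/fintype.subsetP DT' sT' cT']; exists T'; split=> //.
  apply/negP=> dT'; have eT' : e \in T' by apply: DT'; rewrite setU11.
  by have := noncrossing_cross sT'.1 eT' dT'; rewrite ed.
by move=> f fT fd fd'; apply: DT'; rewrite !inE fT fd fd' !orbT.
Qed.
End CentralSymmetry.

(** * The labels *)

Section Labels.
Variables (m : nat) (A : rel nat).
Notation U := (up m A).
Notation lab := (@label m A).
Notation vtx := (vertex m A).
Implicit Types (a b c i j k : nat) (u v w t : 'I_m.+2).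

Definition pos a : nat := index a (labels m A).

Definition before a b : bool :=
  if U a then U b && (b < a) else U b || (a < b).

Lemma up_bounds a : U a -> 1 < a < m.
Proof. by case/andP; lia. Qed.

Lemma before_trans : transitive before.
Proof.
by move=> b a c; rewrite /before; case: (U a); case: (U b); case: (U c) => /=; lia.
Qed.

Lemma before_asym a b : before a b -> before b a -> false.
Proof. by rewrite /before; case: (U a); case: (U b) => /=; lia. Qed.

Lemma mem_labels a : (a \in labels m A) = (a < m.+2).
Proof.
rewrite /labels inE mem_cat inE mem_rev !mem_filter mem_iota.
by case: (U a) (@up_bounds a) => /=; lia.
Qed.

Lemma pairwise_labels : pairwise before (labels m A).
Proof.
have down0 : U 0 = false by [].
have downm : U m.+1 = false by apply/negP=> /up_bounds; lia.
have s_lt : pairwise ltn (iota 1 m).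
  by rewrite -sorted_pairwise ?iota_ltn_sorted //; exact: ltn_trans.
rewrite /labels pairwise_cons pairwise_cat pairwise_cons.
have allU (P Q : pred nat) : (forall a, 0 < a < m.+1 -> P a -> Q a) ->
    all Q [seq a <- iota 1 m | P a].
  move=> PQ; apply/allP => a; rewrite mem_filter mem_iota => /andP[Pa am].
  by apply: PQ => //; lia.
apply/andP; split; first (rewrite all_cat /= all_rev; apply/and3P; split).
- by apply: allU => a; rewrite /before down0 => /andP[-> _] _; rewrite orbT.
- by rewrite /before down0 orbT.
- by apply: allU => a; rewrite /before down0 => /andP[-> _] _; rewrite orbT.
apply/and4P; split.
- rewrite allrel_consr; apply/andP; split.
    by apply: allU => a am /negPf Ua; rewrite /before Ua downm /=; lia.
  apply/allrelP=> a b; rewrite mem_rev !mem_filter.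
  by move=> /andP[/negPf Ua _] /andP[Ub _]; rewrite /before Ua Ub.
- move: s_lt => /(pairwise_filter (fun a => ~~ U a)).
  apply: (sub_in_pairwise (P := [pred a | ~~ U a])); last exact: filter_all.
  by move=> a b; rewrite !inE /before => /negPf-> /negPf ->.
- by rewrite all_rev; apply: allU => a _ Ua; rewrite /before downm Ua.
rewrite -(sorted_pairwise before_trans) rev_sorted.
apply: pairwise_sorted; move: s_lt => /(pairwise_filter U).
apply: (sub_in_pairwise (P := [pred a | U a])); last exact: filter_all.
by move=> a b; rewrite !inE /before => -> ->.
Qed.

Lemma uniq_labels : uniq (labels m A).
Proof.
apply: (pairwise_uniq _ pairwise_labels) => a.
by apply/negP => h; have := before_asym h h.
Qed.

Lemma size_labels : size (labels m A) = m.+2.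
Proof.
rewrite -(size_iota 0 m.+2); apply/perm_size/uniq_perm.
- exact: uniq_labels.
- exact: iota_uniq.
by move=> a; rewrite mem_labels mem_iota.
Qed.

Lemma pos_lt a : a < m.+2 -> pos a < m.+2.
Proof. by move=> am; rewrite -size_labels index_mem mem_labels. Qed.

Lemma lab_lt v : lab v < m.+2.
Proof. by rewrite -mem_labels mem_nth // size_labels. Qed.

Lemma pos_lab v : pos (lab v) = v.
Proof. by rewrite /pos index_uniq ?size_labels ?uniq_labels. Qed.

Lemma val_vertex a : a < m.+2 -> vtx a = pos a :> nat.
Proof. by move=> am; rewrite inordK ?pos_lt. Qed.

Lemma lab_vertex a : a < m.+2 -> lab (vtx a) = a.
Proof. by move=> am; rewrite /label val_vertex // nth_index ?mem_labels. Qed.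

Lemma vertex_lab v : vtx (lab v) = v.
Proof. by apply/ord_inj; rewrite val_vertex ?lab_lt ?pos_lab. Qed.

Lemma pos_ltE a b : a < m.+2 -> b < m.+2 -> (pos a < pos b) = before a b.
Proof.
move=> am bm.
have H x y : x < m.+2 -> y < m.+2 -> pos x < pos y -> before x y.
  move=> xm ym; apply: (sorted_ltn_index before_trans); rewrite ?mem_labels //.
  by rewrite sorted_pairwise ?pairwise_labels //; exact: before_trans.
apply/idP/idP; first exact: H.
move=> h; rewrite ltnNge; apply/negP; rewrite leq_eqVlt => /orP[/eqP e|/H h'].
  have e' : b = a by rewrite -(lab_vertex am) -(lab_vertex bm); congr label;
    apply/ord_inj; rewrite !val_vertex.
  by move: h; rewrite e' => h; have := before_asym h h.
by have := before_asym h (h' bm am).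
Qed.

Lemma pos0 : pos 0 = 0.
Proof. by []. Qed.

(* For [a < b]: the label [i] lies strictly below the line from [a] to [b] or is
an up end point of it. *)
Definition below a b i : bool :=
  if U i then U a && (i <= a) || U b && (b <= i)
  else (U a || (a < i)) && (U b || (i < b)).

(* For [a < b]: the number of boundary edges below the line from [a] to [b]. *)
Definition width a b : nat := pos b + (if U a then m.+2 else 0) - pos a.

Lemma widthE a b : a < b < m.+2 ->
  width a b + pos a = pos b + (if U a then m.+2 else 0) /\
  0 < width a b < m.+2.
Proof.
move=> /andP[ab bm]; have am := ltn_trans ab bm.
have := pos_lt am; have := pos_lt bm.
have := pos_ltE am bm; have := pos_ltE bm am.
by rewrite /width /before; case: (U a); case: (U b); lia.
Qed.

Lemma width_mid a i b : a < i -> i < b -> b < m.+2 ->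
  width a i + width i b = width a b + (if U i then m.+2 else 0).
Proof.
move=> ai ib bm.
have ai_m : a < i < m.+2 by rewrite ai (ltn_trans ib).
have ib_m : i < b < m.+2 by rewrite ib.
have ab_m : a < b < m.+2 by rewrite (ltn_trans ai).
have := widthE ai_m; have := widthE ib_m; have := widthE ab_m; lia.
Qed.

Lemma below_mid a i b k : a < i -> i < b ->
  (below a i k + below i b k + (~~ U i && (k == i)) =
  below a b k + U i + (U i && (k == i)))%N.
Proof.
rewrite /below; have [->|ki] := eqVneq k i.
  by case: (U i); case: (U a); case: (U b) => /=; lia.
by case: (U k); case: (U i); case: (U a); case: (U b) => /=; lia.
Qed.

Lemma below_swap a b c d k : a < b -> c < d -> a < d -> c < b ->
  (below a b k + below c d k = below a d k + below c b k)%N.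
Proof.
rewrite /below.
by case: (U k); case: (U a); case: (U b); case: (U c); case: (U d) => /=; lia.
Qed.

Lemma pos_sum a : a < m.+2 -> pos a = \sum_(k < m.+2) before k a.
Proof.
move=> am.
have -> : pos a = \sum_(p < m.+2) (p < pos a).
  rewrite (eq_bigr (fun p : 'I_m.+2 => if p < pos a then 1 else 0)) => [|p _];
    last by case: ifP.
  rewrite -big_mkcond -(big_ord_widen _ (fun=> 1)) ?sum1_card ?card_ord //.
  exact/ltnW/pos_lt.
rewrite (reindex (fun k : 'I_m.+2 => vtx k)) /=.
  by apply: eq_bigr => k _; rewrite val_vertex // pos_ltE.
exists (fun v => Ordinal (lab_lt v)) => k _ /=; last exact: vertex_lab.
by apply/ord_inj; rewrite /= lab_vertex.
Qed.

Lemma sum_below a b : a < b < m.+2 ->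
  width a b = (\sum_(i < m) below a b i.+1).+1.
Proof.
move=> abm; have [E _] := widthE abm; have /andP[ab bm] := abm.
have am := ltn_trans ab bm.
have Ua := @up_bounds a; have Ub := @up_bounds b.
have sum_at c (Q : bool) : (Q -> 0 < c <= m) ->
    \sum_(i < m) (Q && (i.+1 == c)) = Q.
  case: Q => [/(_ isT) c1|_]; last by rewrite big1.
  have cm : c.-1 < m by lia.
  rewrite (bigD1 (Ordinal cm)) //= prednK ?eqxx; last by lia.
  by rewrite big1 // => i; rewrite -val_eqE /=; case: eqP => //; lia.
have : \sum_(i < m) (before i.+1 b + U a + (U b && (i.+1 == b))) =
    \sum_(i < m) (below a b i.+1 + before i.+1 a + (~~ U a && (0 < a) && (i.+1 == a))).
  apply: eq_bigr => i _; rewrite /below /before.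
  have [->|kb] := eqVneq i.+1 b.
    by case: (U a) Ua; case: (U b) Ub => /=; lia.
  have [ka|ka] := eqVneq i.+1 a.
    by move: (ltn0Sn i); rewrite ka; case: (U a) Ua; case: (U b) Ub => /=; lia.
  by case: (U i.+1); case: (U a); case: (U b) => /=; lia.
rewrite !big_split /= !sum_at; [|by move=> /andP[_]; lia|by move/Ub; lia].
rewrite sum_nat_const card_ord.
have U0 : U 0 = false by [].
have Um : U m.+1 = false by apply/negP=> /up_bounds; lia.
have split_sum c : \sum_(k < m.+2) before k c =
    before 0 c + \sum_(i < m) before i.+1 c + before m.+1 c.
  by rewrite big_ord_recl big_ord_recr /= addnA.
move: E; rewrite (pos_sum am) (pos_sum bm) !split_sum.
move: (\sum_(i < m) _) (\sum_(i < m) _) (\sum_(i < m) _) => x y z.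
rewrite /before U0 Um /=; case: (U a) Ua; case: (U b) Ub => /=; lia.
Qed.

Lemma boundary_below a b : a < b < m.+2 -> boundary_edge (vtx a) (vtx b) ->
  exists t : bool, (forall k, 0 < k <= m -> below a b k = t) /\
    width a b = if t then m.+1 else 1.
Proof.
move=> abm; have /andP[ab bm] := abm; have am := ltn_trans ab bm.
rewrite boundary_edgeE !val_vertex // => bnd.
have U0 : U 0 = false by [].
have Um : U m.+1 = false by apply/negP=> /up_bounds; lia.
have pb0 : 0 < pos b.
  by rewrite -[0]/(pos 0) pos_ltE // /before U0; case: (U b) => //=; lia.
have [t Ht] : exists t : bool, forall k, 0 < k <= m -> below a b k = t.
  exists ((pos a).+1 != pos b) => k k1.
  have km : k < m.+2 by lia.
  have ab' := pos_ltE am bm; have ba' := pos_ltE bm am.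
  have ak' := pos_ltE am km; have ka' := pos_ltE km am.
  have bk' := pos_ltE bm km; have kb' := pos_ltE km bm.
  have p0a := @pos_ltE 0 a isT am; rewrite pos0 in p0a.
  have pam := @pos_ltE a m.+1 am (ltnSn _).
  have pma := @pos_ltE m.+1 a (ltnSn _) am.
  have pbm := @pos_ltE b m.+1 bm (ltnSn _).
  have pmb := @pos_ltE m.+1 b (ltnSn _) bm.
  have pm_m := @pos_lt m.+1 (ltnSn _).
  have := pos_lt am; have := pos_lt bm; have := pos_lt km.
  have Ua := @up_bounds a; have Ub := @up_bounds b.
  move: ab' ba' ak' ka' bk' kb' p0a pam pma pbm pmb Ua Ub pm_m.
  rewrite /before U0 Um /below.
  have [E|E] := eqVneq (pos a).+1 (pos b).
    by rewrite -E; case: (U a); case: (U b); case: (U k) => /=; lia.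
  move: bnd; rewrite (negPf E) /= => /or3P[/eqP bnd|/andP[/eqP h1 /eqP h2]|].
  - by rewrite -bnd; case: (U a); case: (U b); case: (U k) => /=; lia.
  - by rewrite h1 h2; case: (U a); case: (U b); case: (U k) => /=; lia.
  - by rewrite eqn0Ngt pb0.
exists t; split=> //; rewrite (sum_below abm).
rewrite (eq_bigr (fun=> nat_of_bool t)); last by move=> i _; rewrite Ht ?ltn_ord.
by rewrite sum_nat_const card_ord; case: (t) => /=; lia.
Qed.

Lemma find_iotaE (P : pred nat) n k : k < n -> P k ->
  (forall j, j < k -> ~~ P j) -> find P (iota 0 n) = k.
Proof.
move=> kn Pk Pj; apply/eqP; rewrite eqn_leq; apply/andP; split.
  rewrite leqNgt; apply/negP => h.
  by have := before_find 0 h; rewrite nth_iota // Pk.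
rewrite leqNgt; apply/negP => h.
have hs : has P (iota 0 n) by apply/hasP; exists k; rewrite ?mem_iota.
have := nth_find 0 hs; rewrite nth_iota; last first.
  by rewrite -[X in _ < X](size_iota 0 n) -has_find.
exact/negP/Pj.
Qed.

Lemma val_walk ccw u k : k < m.+2 ->
  walk ccw u k = (if ccw then if u + k < m.+2 then u + k else u + k - m.+2
                  else if k <= u then u - k else u + m.+2 - k) :> nat.
Proof. by move=> km; case: ccw; rewrite /walk ?val_addn ?val_subn. Qed.

End Labels.

Section Labels.
Variables (m : nat) (A : rel nat).
Notation U := (up m A).
Notation lab := (@label m A).
Notation vtx := (vertex m A).
Implicit Types (a b c i j k : nat) (u v : 'I_m.+2).

Notation pos := (@pos m A).
Notation before := (@before m A).
Notation width := (@width m A).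
Notation below := (@below m A).

Lemma mu_walk i j ccw k : i < m.+2 -> j < m.+2 -> 0 < k < m.+2 ->
  let allowed a := if j < i then a <= i else i <= a in
  walk ccw (vtx i) k = vtx j ->
  (forall t, t <= k -> allowed (lab (walk ccw (vtx i) t))) ->
  ~~ allowed (lab (walk (~~ ccw) (vtx i) 1)) ->
  mu m A i j = k.
Proof.
move=> im jm /andP[k0 km] allowed wk all_k not1.
have walk_inj b : b < m.+2 -> walk ccw (vtx i) b = walk ccw (vtx i) k -> b = k.
  move=> bm /(congr1 (@nat_of_ord _)); rewrite !val_walk //.
  have := ltn_ord (vtx i).
  case: (ccw); first by case: ifP; case: ifP; lia.
  by case: (leqP b (vtx i)); case: (leqP k (vtx i)); lia.
apply: find_iotaE => // [|b bk].
  apply/existsP; exists ccw; rewrite wk eqxx; apply/allP => t.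
  by rewrite mem_iota add0n ltnS => /andP[_]; exact: all_k.
apply/existsP => -[c /andP[/eqP wb /allP all_b]].
have [cE|cE] := eqVneq c ccw.
  have := walk_inj b (ltn_trans bk km); rewrite wk -cE wb => /(_ erefl); lia.
have cE' : c = ~~ ccw by case: (c) (ccw) cE => [] [].
have [b0|b0] := posnP b.
  have ij : vtx i = vtx j.
    rewrite -wb b0 /walk; case: (c); rewrite ?addr0 ?subr0 //.
  have := walk_inj 0; rewrite wk -ij => /(_ isT) h.
  by move: k0; rewrite -h // /walk; case: (ccw); rewrite ?addr0 ?subr0.
by case/negP: not1; rewrite -cE'; apply: all_b; rewrite mem_iota; lia.
Qed.

Lemma before_pos a b : a < m.+2 -> b < m.+2 -> before a b = (pos a < pos b).
Proof. by move=> am bm; rewrite pos_ltE. Qed.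

Lemma walk_label ccw i t : exists2 k, k < m.+2 &
  lab (walk ccw (vtx i) t) = k /\ walk ccw (vtx i) t = pos k :> nat.
Proof.
by exists (lab (walk ccw (vtx i) t)); rewrite ?lab_lt ?pos_lab.
Qed.

Lemma walk1_label i : 0 < i <= m ->
  lab (walk (U i) (vtx i) 1) < i /\ i < lab (walk (~~ U i) (vtx i) 1).
Proof.
move=> i1; have im : i < m.+2 by lia.
have pi_m : pos i < m.+2 := @pos_lt m A _ im.
have Um : U m.+1 = false by apply/negP=> /up_bounds; lia.
have U0 : U 0 = false by [].
have pm : pos m.+1 < m.+2 by apply: pos_lt.
have b0i : before 0 i = (0 < pos i) by rewrite before_pos.
have bim : before i m.+1 = (pos i < pos m.+1) by rewrite before_pos.
have bmi : before m.+1 i = (pos m.+1 < pos i) by rewrite before_pos.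
have [k km [-> ]] := walk_label (U i) i 1.
have [l lm [-> ]] := walk_label (~~ U i) i 1.
have bki : before k i = (pos k < pos i) by rewrite before_pos.
have bik : before i k = (pos i < pos k) by rewrite before_pos.
have bli : before l i = (pos l < pos i) by rewrite before_pos.
have bil : before i l = (pos i < pos l) by rewrite before_pos.
have b0k : before 0 k = (0 < pos k) by rewrite before_pos.
have bml : before m.+1 l = (pos m.+1 < pos l) by rewrite before_pos.
have blm : before l m.+1 = (pos l < pos m.+1) by rewrite before_pos.
rewrite !val_walk ?val_vertex //.
move: b0i bim bmi bki bik bli bil b0k bml blm; rewrite /before Um U0.
case: (U i); case: (U k); case: (U l) => /=;
  case: (ltnP (pos i + 1)); case: (leqP 1 (pos i)); lia.
Qed.

Lemma muE i j : 0 < i <= m -> j < m.+2 -> j <> i ->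
  let w := if j < i then width j i else width i j in
  mu m A i j = if U i then m.+2 - w else w.
Proof.
move=> i1 jm ji /=; have im : i < m.+2 by lia.
have pi_m : pos i < m.+2 := @pos_lt m A _ im.
have pj_m : pos j < m.+2 := @pos_lt m A _ jm.
have bi k : k < m.+2 -> (before k i = (pos k < pos i)) * (before i k = (pos i < pos k)).
  by move=> km; rewrite !before_pos.
have bj k : k < m.+2 -> (before k j = (pos k < pos j)) * (before j k = (pos j < pos k)).
  by move=> km; rewrite !before_pos.
have bji : before j i = (pos j < pos i) by rewrite before_pos.
have bij : before i j = (pos i < pos j) by rewrite before_pos.
case: (ltngtP j i) => [lji|lij|//].
  have [|E w0] := @widthE m A j i; first by rewrite lji.
  have allowedE (c : bool) t : (if j < i then lab (walk c (vtx i) t) <= i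
      else i <= lab (walk c (vtx i) t)) = (lab (walk c (vtx i) t) <= i).
    by rewrite lji.
  case: (boolP (U i)) => Ui.
    apply: (@mu_walk i j true) => //; rewrite ?allowedE; first by lia.
    + apply/ord_inj; rewrite val_walk ?val_vertex //; last by lia.
      move: E bji; rewrite /before Ui; case: (U j) => /=; case: (ltnP (pos i + _)); lia.
    + move=> t tw; rewrite allowedE; have [k km [-> ]] := walk_label true i t.
      rewrite val_walk ?val_vertex //; last by lia.
      move: E bji (bi k km) (bj k km) => E bji' [bi1 bi2] [bj1 bj2].
      move: E bji' bi1 bi2 bj1 bj2; rewrite /before Ui;
        case: (U j); case: (U k) => /=; case: (ltnP (pos i + _)); lia.
    + by have := walk1_label i1; rewrite ?Ui ?(negPf Ui) -?ltnNge => -[].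
  apply: (@mu_walk i j false) => //; rewrite ?allowedE.
  + apply/ord_inj; rewrite val_walk ?val_vertex //; last by lia.
    move: E bji; rewrite /before (negPf Ui);
      case: (U j) => /=; case: (leqP (width j i) (pos i)); lia.
  + move=> t tw; rewrite allowedE; have [k km [-> ]] := walk_label false i t.
    rewrite val_walk ?val_vertex //; last by lia.
    move: E bji (bi k km) (bj k km) => E bji' [bi1 bi2] [bj1 bj2].
    move: E bji' bi1 bi2 bj1 bj2; rewrite /before (negPf Ui);
      case: (U j); case: (U k) => /=; case: (leqP t (pos i)); lia.
  + by have := walk1_label i1; rewrite ?Ui ?(negPf Ui) -?ltnNge => -[].
have [|E w0] := @widthE m A i j; first by rewrite lij.
have allowedE (c : bool) t : (if j < i then lab (walk c (vtx i) t) <= i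
    else i <= lab (walk c (vtx i) t)) = (i <= lab (walk c (vtx i) t)).
  by rewrite ltnNge ltnW.
case: (boolP (U i)) => Ui.
  apply: (@mu_walk i j false) => //; rewrite ?allowedE; first by lia.
  + apply/ord_inj; rewrite val_walk ?val_vertex //; last by lia.
    move: E bij; rewrite Ui; case: (leqP (m.+2 - width i j) (pos i)); lia.
  + move=> t tw; rewrite allowedE; have [k km [-> ]] := walk_label false i t.
    rewrite val_walk ?val_vertex //; last by lia.
    move: E bij (bi k km) (bj k km) => E bij' [bi1 bi2] [bj1 bj2].
    move: E bij' bi1 bi2 bj1 bj2; rewrite /before Ui;
      case: (U j); case: (U k) => /=; case: (leqP t (pos i)); lia.
  + by have := walk1_label i1; rewrite ?Ui ?(negPf Ui) -?ltnNge => -[].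
apply: (@mu_walk i j true) => //; rewrite ?allowedE.
+ apply/ord_inj; rewrite val_walk ?val_vertex //; last by lia.
  move: E bij; rewrite (negPf Ui); case: (ltnP (pos i + _)); lia.
+ move=> t tw; rewrite allowedE; have [k km [-> ]] := walk_label true i t.
  rewrite val_walk ?val_vertex //; last by lia.
  move: E bij (bi k km) (bj k km) => E bij' [bi1 bi2] [bj1 bj2].
  move: E bij' bi1 bi2 bj1 bj2; rewrite /before (negPf Ui);
        case: (U j); case: (U k) => /=; case: (ltnP (pos i + _)); lia.
+ by have := walk1_label i1; rewrite ?Ui ?(negPf Ui) -?ltnNge => -[].
Qed.

Lemma graph_edge_walk1 T ccw (u : 'I_m.+2) : graph_edge T u (walk ccw u 1).
Proof.
by rewrite /graph_edge /boundary_edge /walk; case: ccw; rewrite ?subrK eqxx ?orbT.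
Qed.

Lemma triangle_at T i : saturated T -> 0 < i <= m -> exists a b,
  [/\ a < i < b, b < m.+2,
      [/\ graph_edge T (vtx a) (vtx i), graph_edge T (vtx i) (vtx b)
        & graph_edge T (vtx a) (vtx b)],
      p_l A T i = (if U i then m.+2 - width a i else width a i)
    & p_r A T i = (if U i then m.+2 - width i b else width i b)].
Proof.
move=> sT i1; have im : i < m.+2 by lia.
have [nl nr] := walk1_label i1.
set l := lab _ in nl; set r := lab _ in nr.
have lm : l < m.+2 := lab_lt _ _; have rm : r < m.+2 := lab_lt _ _.
have Pl : (l < i) && graph_edge T (vtx l) (vtx i).
  by rewrite nl vertex_lab graph_edgeC graph_edge_walk1.
have Pr : (i < r) && graph_edge T (vtx i) (vtx r).
  by rewrite nr vertex_lab graph_edge_walk1.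
pose PL := fun a : 'I_m.+2 => (a < i) && graph_edge T (vtx a) (vtx i).
pose PR := fun b : 'I_m.+2 => (i < b) && graph_edge T (vtx i) (vtx b).
have := @bigop.bigmax_eq_arg _ (Ordinal lm) PL (fun a : 'I_m.+2 => mu m A i a) Pl.
have := @bigop.bigmax_eq_arg _ (Ordinal rm) PR (fun a : 'I_m.+2 => mu m A i a) Pr.
rewrite -/(p_l A T i) -/(p_r A T i).
case: arg_maxnP => // b /andP[ib Eib] bmax; case: arg_maxnP => // a /andP[ai Eai] amax.
have mu_l k : k < i -> mu m A i k = if U i then m.+2 - width k i else width k i.
  by move=> ki; rewrite muE ?ki //; lia.
have mu_r k : i < k < m.+2 -> mu m A i k = if U i then m.+2 - width i k else width i k.
  by move=> ik; rewrite muE ?ltnNge //; [rewrite ltnW //=; lia|lia..].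
rewrite /= (mu_l a ai) (mu_r b) ?ib ?ltn_ord // => -> ->.
exists a, b; split; rewrite ?ai ?ltn_ord //; split=> //.
have am := ltn_ord a; have bm := ltn_ord b.
have pa_m := @pos_lt m A _ am; have pb_m := @pos_lt m A _ bm.
have pi_m := @pos_lt m A _ im.
have [|Ea wa] := @widthE m A a i; first by rewrite ai.
have [|Eb wb] := @widthE m A i b; first by rewrite ib.
have [|Eab wab] := @widthE m A a b; first by rewrite (ltn_trans ai ib).
have nbr (w : 'I_m.+2) :
    cyc (if U i then pos a else pos b) w (if U i then pos b else pos a) ->
    ~~ graph_edge T (vtx i) w.
  move=> cw; apply/negP; rewrite -(vertex_lab A w) => iw.
  have wE : pos (lab w) = w by apply: pos_lab.
  have km := lab_lt A w; have w_lt := ltn_ord w.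
  case: (ltngtP (lab w) i) => [ki|ik|ei].
  - have := amax (Ordinal km); rewrite /PL /geq /= ki graph_edgeC iw => /(_ isT).
    rewrite !mu_l //; have [|Ek wk] := @widthE m A (lab w) i; first by rewrite ki.
    move: Ek wk Ea wa Eb wb Eab wab cw; rewrite wE /cyc.
    by case: (U i); case: (U a); case: (U (lab w)); lia.
  - have := bmax (Ordinal km); rewrite /PR /geq /= ik iw => /(_ isT).
    rewrite !mu_r ?ik ?ib //; have [|Ek wk] := @widthE m A i (lab w); first by rewrite ik.
    move: Ek wk Ea wa Eb wb Eab wab cw; rewrite wE /cyc.
    by case: (U i); case: (U a); case: (U (lab w)); lia.
  move: cw Ea wa Eb wb Eab wab; rewrite -wE ei /cyc.
  by case: (U i); case: (U a); lia.
case: (boolP (U i)) nbr Ea wa Eb wb Eab wab => Ui nbr Ea wa Eb wb Eab wab.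
  apply: (fan sT (p := vtx i)) => //; first by rewrite graph_edgeC.
    rewrite !val_vertex //; move: Ea wa Eb wb Eab wab; rewrite /cyc.
    by case: (U a); lia.
  by move=> w; rewrite !val_vertex // => /nbr.
rewrite graph_edgeC.
apply: (fan sT (p := vtx i)) => //; first by rewrite graph_edgeC.
  rewrite !val_vertex //; move: Ea wa Eb wb Eab wab; rewrite /cyc.
  by case: (U a); lia.
by move=> w; rewrite !val_vertex // => /nbr.
Qed.
End Labels.

(** * The defining inequalities of the associahedron *)

Local Open Scope ring_scope.

Lemma binomial2R (F : numFieldType) k : 'C(k, 2)%:R = k%:R * (k%:R - 1) / 2 :> F.
Proof.
have two : 2 != 0 :> F by rewrite pnatr_eq0.
apply: (mulIf two); rewrite divfK // -natrM.
case: k => [|k]; first by rewrite bin0n mul0r.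
by rewrite mulnC -mul_bin_diag bin1 natrM -[in X in _ = _ * X]natr1 addrK.
Qed.

Lemma binomial2_convex p q r s : (p + q = r + s -> p < r -> p < s ->
  'C(r, 2) + 'C(s, 2) < 'C(p, 2) + 'C(q, 2))%N.
Proof.
move=> E pr ps; rewrite -(ltr_nat rat) !natrD !binomial2R.
have -> : q = (r + s - p)%N by lia.
have -> : r = (r - p + p)%N by lia.
have -> : s = (s - p + p)%N by lia.
have : 0 < (r - p)%N%:R * (s - p)%N%:R :> rat by rewrite mulr_gt0 // ltr0n subn_gt0.
have -> : (r - p + p + (s - p + p) - p = r - p + (s - p) + p)%N by lia.
rewrite !natrD; move: ((r - p)%N%:R) ((s - p)%N%:R) (p%:R : rat) => x y z; nra.
Qed.

Section Functionals.
Variables (R : realType) (m : nat) (A : rel nat).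
Notation U := (up m A).
Notation lab := (@label m A).
Notation vtx := (vertex m A).
Notation pos := (@pos m A).
Notation before := (@before m A).
Notation width := (@width m A).
Notation below := (@below m A).
Implicit Types (a b c d : nat) (u v w t : 'I_m.+2)
  (T D : {set {set 'I_m.+2}}) (x y : 'rV[R]_m).

Definition below_row a b : 'rV[R]_m := \row_i (below a b i.+1)%:R.

(* There are [width a b - 1] labels below [a b], so the binomial coefficient is
the minimum of the sum of their coordinates over the permutahedron. *)
Definition slack x a b : R :=
  (below_row a b *m x^T) 0 0 - 'C(width a b, 2)%:R.

Definition edge_slack x u v : R :=
  slack x (minn (lab u) (lab v)) (maxn (lab u) (lab v)).

Definition ends (d : {set 'I_m.+2}) : 'I_m.+2 * 'I_m.+2 :=
  odflt (ord0, ord0) [pick p : 'I_m.+2 * 'I_m.+2 | d == [set p.1; p.2]].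

Definition diag_slack x (d : {set 'I_m.+2}) : R := edge_slack x (ends d).1 (ends d).2.

Definition balanced x : Prop := \sum_i x 0 i = 'C(m.+1, 2)%:R.

Lemma dotE (c x : 'rV[R]_m) : (c *m x^T) 0 0 = \sum_i c 0 i * x 0 i.
Proof. by rewrite mxE; apply: eq_bigr => i _; rewrite mxE. Qed.

Lemma edge_slackC x u v : edge_slack x u v = edge_slack x v u.
Proof. by rewrite /edge_slack minnC maxnC. Qed.

Lemma diag_slackE x u v : diag_slack x [set u; v] = edge_slack x u v.
Proof.
rewrite /diag_slack /ends; case: pickP => [p /eqP E|/(_ (u, v))]; last by rewrite eqxx.
by case: (set2_inj E) => -[-> ->] //; exact: edge_slackC.
Qed.

Lemma edge_slack_vertex x a b : (a < b < m.+2)%N ->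
  edge_slack x (vtx a) (vtx b) = slack x a b.
Proof.
move=> /andP[ab bm]; have am := ltn_trans ab bm.
by rewrite /edge_slack !lab_vertex // (minn_idPl (ltnW ab)) (maxn_idPr (ltnW ab)).
Qed.

Lemma slack_boundary x a b : balanced x -> (a < b < m.+2)%N ->
  boundary_edge (vtx a) (vtx b) -> slack x a b = 0.
Proof.
move=> bx ab /(boundary_below ab)[t [tE wE]].
rewrite /slack dotE (eq_bigr (fun i => t%:R * x 0 i)); last first.
  by move=> i _; rewrite mxE tE // ltn_ord.
rewrite -mulr_sumr bx wE; case: t {tE wE}; first by rewrite mul1r subrr.
by rewrite mul0r subrr.
Qed.

Lemma edge_slack_boundary x u v : balanced x -> boundary_edge u v ->
  edge_slack x u v = 0.
Proof.
move=> bx; rewrite -(vertex_lab A u) -(vertex_lab A v).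
move: (lab_lt A u) (lab_lt A v); move: (lab u) (lab v) => a b am bm.
case: (ltngtP a b) => [ab|ba|->] h.
- by rewrite edge_slack_vertex ?ab // slack_boundary ?ab.
- rewrite boundary_edgeC in h.
  by rewrite edge_slackC edge_slack_vertex ?ba // slack_boundary ?ba.
by move: h; rewrite boundary_edgeE val_vertex //; lia.
Qed.

Lemma slack_mid x a (i : 'I_m) b : balanced x -> (a < i.+1 < b)%N -> (b < m.+2)%N ->
  let w := width a i.+1 in let w' := width i.+1 b in
  let s := slack x a b - slack x a i.+1 - slack x i.+1 b in
  x 0 i = if U i.+1 then m.+1%:R - ((m.+2 - w) * (m.+2 - w'))%N%:R - s
          else (w * w')%N%:R + s.
Proof.
move=> bx /andP[ai ib] bm w w' s.
have [|Ea wa] := @widthE m A a i.+1; first by rewrite ai (ltn_trans ib).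
have [|Eb wb] := @widthE m A i.+1 b; first by rewrite ib.
have wN : (w <= m.+2)%N by case/andP: wa => _ /ltnW.
have wN' : (w' <= m.+2)%N by case/andP: wb => _ /ltnW.
have wab := @width_mid m A a i.+1 b ai ib bm.
have K : (below_row a b *m x^T) 0 0 - (below_row a i.+1 *m x^T) 0 0
    - (below_row i.+1 b *m x^T) 0 0 =
    if U i.+1 then - 'C(m.+1, 2)%:R - x 0 i else x 0 i.
  rewrite !dotE.
  have -> : x 0 i = \sum_(k < m) (k == i)%:R * x 0 k.
    rewrite (bigD1 i) //= eqxx mul1r big1 ?addr0 // => k /negPf ->.
    by rewrite mul0r.
  rewrite -bx -!sumrB; case: (boolP (U i.+1)) => Ui.
    rewrite -sumrN -sumrB; apply: eq_bigr => k _; rewrite !mxE.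
    have := @below_mid m A a i.+1 b k.+1 ai ib; rewrite Ui eqSS /=.
    move/(congr1 (fun n => n%:R : R)); rewrite !natrD -[k == i]/(val k == val i) => E.
    by move: (congr1 (fun z => z * x 0 k) E); lra.
  apply: eq_bigr => k _; rewrite !mxE.
  have := @below_mid m A a i.+1 b k.+1 ai ib; rewrite (negPf Ui) eqSS /=.
  move/(congr1 (fun n => n%:R : R)); rewrite !natrD -[k == i]/(val k == val i) => E.
  by move: (congr1 (fun z => z * x 0 k) E); lra.
have sE : s = (if U i.+1 then - 'C(m.+1, 2)%:R - x 0 i else x 0 i)
    - 'C(width a b, 2)%:R + 'C(w, 2)%:R + 'C(w', 2)%:R.
  by rewrite -K /s /slack -/w -/w'; ring.
move: wab; rewrite sE !binomial2R -/w -/w' => {K sE s}.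
case: (U i.+1) => /(congr1 (fun n => n%:R : R)); rewrite !natrD => E.
  rewrite natrM (natrB _ wN) (natrB _ wN').
  have -> : (width a b)%:R = w%:R + w'%:R - m.+2%:R :> R by lra.
  by rewrite -[m.+2%:R]natr1 -[m.+1%:R]natr1; lra.
have -> : (width a b)%:R = w%:R + w'%:R :> R by lra.
by rewrite natrM; lra.
Qed.

Lemma slack_cross x a b c d : (a < b < m.+2)%N -> (c < d < m.+2)%N ->
  (a < d)%N -> (c < b)%N ->
  slack x a b + slack x c d - slack x a d - slack x c b =
  'C(width a d, 2)%:R + 'C(width c b, 2)%:R
  - 'C(width a b, 2)%:R - 'C(width c d, 2)%:R.
Proof.
move=> /andP[ab bm] /andP[cd dm] ad cb.
have E : (below_row a b *m x^T) 0 0 + (below_row c d *m x^T) 0 0 =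
    (below_row a d *m x^T) 0 0 + (below_row c b *m x^T) 0 0.
  rewrite !dotE -!big_split; apply: eq_bigr => k _ /=.
  by rewrite !mxE -!mulrDl -!natrD below_swap.
by rewrite /slack; lra.
Qed.

(* [a j] and [i b] cross if [i] and [j] are on the same side of the polygon,
[a b] and [i j] cross otherwise; [a i] and [j b] never do. *)
Lemma slack_uncross x a i j b : (a < i < j)%N -> (j < b < m.+2)%N ->
  if U i == U j then slack x a b + slack x i j < slack x a j + slack x i b
  else slack x a j + slack x i b < slack x a b + slack x i j.
Proof.
move=> /andP[ai ij] /andP[jb bm].
have ib := ltn_trans ij jb; have aj := ltn_trans ai ij.
have ab := ltn_trans aj jb; have jm := ltn_trans jb bm.
have abm : (a < b < m.+2)%N by rewrite ab.
have ijm : (i < j < m.+2)%N by rewrite ij.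
have ibm : (i < b < m.+2)%N by rewrite ib.
have ajm : (a < j < m.+2)%N by rewrite aj.
have [_ wab] := widthE A abm; have [_ wij] := widthE A ijm.
have [_ wib] := widthE A ibm; have [_ waj] := widthE A ajm.
have [|_ wai] := @widthE m A a i; first by rewrite ai (ltn_trans ij).
have [|_ wjb] := @widthE m A j b; first by rewrite jb.
have e1 := @width_mid m A a i b ai ib bm.
have e2 := @width_mid m A a i j ai ij jm.
have e3 := @width_mid m A i j b ij jb bm.
have conv p q r s : (p + q = r + s)%N -> (p < r)%N -> (p < s)%N ->
    'C(r, 2)%:R + 'C(s, 2)%:R < 'C(p, 2)%:R + 'C(q, 2)%:R :> R.
  by move=> e lr ls; rewrite -!natrD ltr_nat; apply: binomial2_convex.
have E := slack_cross x abm ijm aj ib.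
case: (U i) e1 e2; case: (U j) e3 => /= e3 e1 e2.
- have := conv (width a b) (width i j) (width a j) (width i b).
  by do 3![move=> /(_ ltac:(lia))]; lra.
- have := conv (width a j) (width i b) (width a b) (width i j).
  by do 3![move=> /(_ ltac:(lia))]; lra.
- have := conv (width i b) (width a j) (width a b) (width i j).
  by do 3![move=> /(_ ltac:(lia))]; lra.
have := conv (width i j) (width a b) (width a j) (width i b).
by do 3![move=> /(_ ltac:(lia))]; lra.
Qed.

Definition lab_slack x a b : R := slack x (minn a b) (maxn a b).

Lemma lab_slack_uncross x a b c d :
  (a < m.+2)%N -> (b < m.+2)%N -> (c < m.+2)%N -> (d < m.+2)%N ->
  alternate (pos a) (pos b) (pos c) (pos d) ->
  lab_slack x a c + lab_slack x b d < lab_slack x a b + lab_slack x c d \/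
  lab_slack x a d + lab_slack x b c < lab_slack x a b + lab_slack x c d.
Proof.
have slackC y e f : lab_slack y e f = lab_slack y f e.
  by rewrite /lab_slack minnC maxnC.
have slackE y e f : (e < f)%N -> lab_slack y e f = slack y e f.
  by move=> ef; rewrite /lab_slack (minn_idPl (ltnW ef)) (maxn_idPr (ltnW ef)).
have core a' b' c' d' : (a' < b' < m.+2)%N -> (a' < c' < d')%N -> (d' < m.+2)%N ->
    alternate (pos a') (pos b') (pos c') (pos d') ->
    lab_slack x a' d' + lab_slack x b' c' < lab_slack x a' b' + lab_slack x c' d'.
  move=> /andP[ab bm] /andP[ac cd] dm.
  have am := ltn_trans ab bm; have cm := ltn_trans cd dm.
  have bp e f : (e < m.+2)%N -> (f < m.+2)%N -> (pos e < pos f)%N = before e f.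
    exact: pos_ltE.
  move=> X; have [bc|cb] := ltnP b' c'.
    by move: X; rewrite /alternate /cyc !bp // /before;
      case: (U a'); case: (U b'); case: (U c'); case: (U d') => /=; lia.
  have {cb} cb : (c' < b')%N.
    rewrite ltn_neqAle cb andbT; apply: contraTneq X => ->.
    by rewrite /alternate /cyc; lia.
  have [bd|db] := ltnP b' d'.
    have ccb : (a' < c' < b')%N by rewrite ac.
    have bdm : (b' < d' < m.+2)%N by rewrite bd.
    have := slack_uncross x ccb bdm; rewrite (slackC _ b') !slackE ?(ltn_trans ac) //.
    case: eqP => [_|nU _]; first by lra.
    by move: X nU; rewrite /alternate /cyc !bp // /before;
      case: (U a'); case: (U b'); case: (U c'); case: (U d') => //=; lia.
  have {db} db : (d' < b')%N.
    rewrite ltn_neqAle db andbT; apply: contraTneq X => ->.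
    by rewrite /alternate /cyc; lia.
  have acd : (a' < c' < d')%N by rewrite ac.
  have dbm : (d' < b' < m.+2)%N by rewrite db.
  have := slack_uncross x acd dbm; rewrite (slackC _ b') !slackE ?(ltn_trans ac) //.
  case: eqP => [eU _|_]; last by lra.
  by move: X eU; rewrite /alternate /cyc !bp // /before;
    case: (U a'); case: (U b'); case: (U c'); case: (U d') => //=; lia.
have alt_sym p q r s : alternate p q r s -> alternate r s p q.
  by rewrite /alternate /cyc; lia.
have min2 a' b' c' d' : (a' < m.+2)%N -> (b' < m.+2)%N -> (c' < m.+2)%N ->
   (d' < m.+2)%N -> (a' < b')%N -> (a' < c')%N -> (a' < d')%N ->
    alternate (pos a') (pos b') (pos c') (pos d') ->
    lab_slack x a' c' + lab_slack x b' d' < lab_slack x a' b' + lab_slack x c' d' \/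
    lab_slack x a' d' + lab_slack x b' c' < lab_slack x a' b' + lab_slack x c' d'.
  move=> am bm cm dm ab ac ad X; have [cd|dc|cd] := ltngtP c' d'.
  - by right; apply: core; rewrite ?ab ?ac.
  - by left; rewrite (slackC _ c'); apply: core; rewrite ?ab ?ad // alternateCr.
  - by move: X; rewrite cd /alternate /cyc; lia.
move=> am bm cm dm X.
have ne e f : (e == f) = true -> pos e = pos f by move/eqP->.
have ab : a != b by apply/negP=> /ne E; move: X; rewrite E /alternate /cyc; lia.
have ac : a != c by apply/negP=> /ne E; move: X; rewrite E /alternate /cyc; lia.
have ad : a != d by apply/negP=> /ne E; move: X; rewrite E /alternate /cyc; lia.
have bc : b != c by apply/negP=> /ne E; move: X; rewrite E /alternate /cyc; lia.
have bd : b != d by apply/negP=> /ne E; move: X; rewrite E /alternate /cyc; lia.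
have cd : c != d by apply/negP=> /ne E; move: X; rewrite E /alternate /cyc; lia.
have [h1|[h1|[h1|h1]]] : (a < b /\ a < c /\ a < d \/ (b < a /\ b < c /\ b < d
   \/ (c < a /\ c < b /\ c < d \/ d < a /\ d < b /\ d < c)))%N by lia.
- by case: h1 => ? [? ?]; apply: min2.
- case: h1 => ? [? ?]; case: (min2 b a c d) => // [|h|h].
  + by rewrite alternateCl.
  + by right; rewrite addrC (slackC _ a b).
  + by left; rewrite addrC (slackC _ a b).
- case: h1 => ? [? ?]; case: (min2 c d a b) => // [|h|h]; first exact: alt_sym.
    by left; rewrite (slackC _ a c) (slackC _ b d) [ltRHS]addrC.
  by right; rewrite addrC (slackC _ b c) (slackC _ a d) [ltRHS]addrC.
- case: h1 => ? [? ?]; case: (min2 d c a b) => // [|h|h].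
  + by rewrite alternateCl; exact: alt_sym.
  + by right; rewrite (slackC _ a d) (slackC _ b c) [ltRHS]addrC (slackC _ c d).
  by left; rewrite addrC (slackC _ a c) (slackC _ b d) [ltRHS]addrC (slackC _ c d).
Qed.

End Functionals.

Section Functionals.
Variables (R : realType) (m : nat) (A : rel nat).
Notation lab := (@label m A).
Notation vtx := (vertex m A).
Implicit Types (u v w t : 'I_m.+2) (d e : {set 'I_m.+2})
  (T D : {set {set 'I_m.+2}}) (x y : 'rV[R]_m).
Notation edge_slack := (@edge_slack R m A).
Notation diag_slack := (@diag_slack R m A).

Lemma edge_slack_uncross x u v w t : alternate u v w t ->
  edge_slack x u w + edge_slack x v t < edge_slack x u v + edge_slack x w t \/
  edge_slack x u t + edge_slack x v w < edge_slack x u v + edge_slack x w t.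
Proof.
move=> X; apply: lab_slack_uncross; rewrite ?lab_lt //.
by rewrite !pos_lab.
Qed.

Definition crossings T u v : {set {set 'I_m.+2}} :=
  [set d in T | crossing [set u; v] d].

Lemma mem_crossings T u v d :
  reflect (d \in T /\ crossing [set u; v] d) (d \in crossings T u v).
Proof. by rewrite inE; exact: andP. Qed.

Lemma edge_slack_edge T x u v : balanced x ->
  (forall d, d \in T -> diag_slack x d = 0) -> graph_edge T u v ->
  edge_slack x u v = 0.
Proof.
move=> bx Tx /orP[/edge_slack_boundary->//|/Tx]; by rewrite diag_slackE.
Qed.

Lemma edge_slack_ge0 T x : saturated T -> balanced x ->
  (forall d, d \in T -> diag_slack x d = 0) ->
  forall u v, u != v ->
  0 <= edge_slack x u v /\ (~~ graph_edge T u v -> 0 < edge_slack x u v).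
Proof.
move=> sT bx Tx u v; have [k] := ubnP #|crossings T u v|.
elim: k u v => // k IHk u v lek uv.
have [Tuv|Tuv] := boolP (graph_edge T u v).
  by rewrite (edge_slack_edge bx Tx Tuv).
suff : 0 < edge_slack x u v by move=> h; split=> //; exact: ltW.
have /exists_inP[d dT cr] : [exists d in T, crossing [set u; v] d].
  apply: contraT => /negP no; case/negP: Tuv; apply/orP.
  case: (boolP (boundary_edge u v)) => [|nb]; [by left|right].
  apply: sT.2 => [|d dT]; first by apply/is_diagonalP.
  by apply/negP => X; apply: no; apply/exists_inP; exists d.
have [w [t [Ed h1 h2]]] : exists w t, [/\ d = [set w; t], cyc u w v & cyc v t u].
  have [w [t [Ed _]]] := diagonalE (noncrossing_diagonal sT.1 dT).
  move: cr; rewrite Ed crossingE => /orP[]/andP[h1 h2].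
    by exists w, t.
  by exists t, w; rewrite finset.setUC.
subst d.
have side (p q : 'I_m.+2) :
    (forall r s, alternate p q r s -> alternate u v r s || alternate w t r s) ->
    ~~ alternate p q w t -> p != q -> 0 <= edge_slack x p q.
  move=> sub npq pq; suff lt : (#|crossings T p q| < k)%N by case: (IHk p q lt pq).
  rewrite ltnS in lek; apply: leq_trans lek; apply/proper_card/properP; split.
    apply/fintype.subsetP => d.
    case/mem_crossings => dT' X; apply/mem_crossings; split; first exact: dT'.
    have [r [s [Ed _]]] := diagonalE (noncrossing_diagonal sT.1 dT').
    subst d; move: X; rewrite !crossingE => /sub/orP[//|].
    by rewrite -crossingE (negPf (noncrossing_cross sT.1 dT dT')).
  exists [set w; t]; first by apply/mem_crossings.
  by apply/mem_crossings => -[_]; rewrite crossingE; apply/negP.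
have sides := alternate_sides h1 h2.
have := edge_slack_uncross x (alternateI h1 h2).
have -> : edge_slack x w t = 0 by rewrite -diag_slackE Tx.
rewrite addr0 => U.
have [uw wv _] := cyc_neq h1; have [vt tu _] := cyc_neq h2.
have e1 : 0 <= edge_slack x u w.
  apply: side => [r s X||//]; first by apply: sides; rewrite X.
  by rewrite alternateCl alternate_share.
have e2 : 0 <= edge_slack x v t.
  apply: side => [r s X||//]; first by apply: sides; rewrite X orbT.
  by rewrite alternateCl alternateCr alternate_share.
have e3 : 0 <= edge_slack x u t.
  apply: side => [r s X||]; first by apply: sides; rewrite X !orbT.
    by rewrite alternateCl alternateCr alternate_share.
  by rewrite eq_sym.
have e4 : 0 <= edge_slack x v w.
  apply: side => [r s X||]; first by apply: sides; rewrite X !orbT.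
    by rewrite alternateCl alternate_share.
  by rewrite eq_sym.
case: U => U; apply: le_lt_trans U; exact: addr_ge0.
Qed.

Lemma coordinate_edge_slack T (i : 'I_m) : saturated T ->
  exists u v w s, [/\ graph_edge T u v, graph_edge T u w, graph_edge T w v &
    forall x, balanced x -> x 0 i = Mpoint R A T 0 i +
      s * (edge_slack x u v - edge_slack x u w - edge_slack x w v)].
Proof.
move=> sT.
have [|a [b [aib bm [ai ib ab] lE rE]]] := @triangle_at m A T i.+1 sT.
  by rewrite /= ltn_ord.
exists (vtx a), (vtx b), (vtx i.+1), (if up m A i.+1 then -1 else 1).
split=> // x bx; have /andP[ai' ib'] := aib.
rewrite !edge_slack_vertex ?ai' ?ib' ?bm ?(ltn_trans ai' ib') ?(ltn_trans ib' bm) //.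
rewrite (slack_mid A bx aib bm) mxE /omega lE rE.
by case: ifP => _; rewrite ?mulN1r ?mul1r.
Qed.

Lemma edge_slack_inj T x y : saturated T -> balanced x -> balanced y ->
  (forall d, d \in T -> diag_slack x d = diag_slack y d) -> x = y.
Proof.
move=> sT bx by_ xy.
have E u v : graph_edge T u v -> edge_slack x u v = edge_slack y u v.
  case/orP=> [h|/xy]; last by rewrite !diag_slackE.
  by rewrite !edge_slack_boundary.
apply/rowP => i.
have [u [v [w [s [uv uw wv H]]]]] := coordinate_edge_slack i sT.
by rewrite (H x bx) (H y by_) !E.
Qed.

Definition diag_row d : 'rV[R]_m :=
  @below_row R m A (minn (lab (ends d).1) (lab (ends d).2))
            (maxn (lab (ends d).1) (lab (ends d).2)).

Definition diag_const d : R :=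
  'C(width m A (minn (lab (ends d).1) (lab (ends d).2))
               (maxn (lab (ends d).1) (lab (ends d).2)), 2)%:R.

Lemma diag_slack_dot x d :
  diag_slack x d = (diag_row d *m x^T) 0 0 - diag_const d.
Proof. by []. Qed.

Lemma saturated_solution T : (0 < m)%N -> saturated T ->
  #|T| = m.-1 /\
  exists x, balanced x /\ forall d, d \in T -> diag_slack x d = 0.
Proof.
move=> m0 sT.
pose M : 'M[R]_(m, #|T|.+1) := \matrix_(i, j)
  if unlift ord0 j is Some k then diag_row (enum_val k) 0 i else 1.
have M0 x : (x *m M) 0 ord0 = \sum_i x 0 i.
  by rewrite mxE; apply: eq_bigr => i _; rewrite mxE unlift_none mulr1.
have MS x k : (x *m M) 0 (lift ord0 k) = (diag_row (enum_val k) *m x^T) 0 0.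
  rewrite dotE mxE; apply: eq_bigr => i _.
  by rewrite [M _ _]mxE liftK mulrC.
have freeM : row_free M.
  apply: inj_row_free => y yM.
  pose x : 'rV[R]_m := const_mx (m.+1%:R / 2).
  have bx : balanced x.
    rewrite /balanced (eq_bigr (fun=> m.+1%:R / 2)); last by move=> i _; rewrite mxE.
    rewrite sumr_const card_ord binomial2R -mulr_natl -[m.+1%:R]natr1; lra.
  have bxy : balanced (x + y).
    rewrite /balanced (eq_bigr (fun i => x 0 i + y 0 i)); last by move=> i _; rewrite mxE.
    by rewrite big_split /= -(M0 y) yM mxE addr0.
  suff : x + y = x by move/(congr1 (fun z => z - x)); rewrite addrC addKr subrr.
  apply: (edge_slack_inj sT) => // d dT.
  rewrite !diag_slack_dot linearD mulmxDr mxE; congr (_ - _).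
  by rewrite -(enum_rankK_in dT dT) -(MS y) yM [X in _ + X]mxE addr0.
have cT : #|T| = m.-1.
  apply/eqP; rewrite eqn_leq noncrossing_card ?(sT.1) //=.
  have := rank_leq_col M; move: freeM; rewrite /row_free => /eqP-> h.
  by rewrite -ltnS prednK.
split=> //.
have fullM : row_full M.
  by move: freeM; rewrite /row_free /row_full => /eqP ->; rewrite cT prednK.
pose b : 'rV[R]_(#|T|.+1) := \row_j
  if unlift ord0 j is Some k then diag_const (enum_val k) else 'C(m.+1, 2)%:R.
have /submxP[x xM] := submx_full b fullM.
exists x; split; first by rewrite /balanced -M0 -xM mxE unlift_none.
move=> d dT; rewrite diag_slack_dot -(enum_rankK_in dT dT) -MS -xM mxE liftK.
by rewrite subrr.
Qed.

Lemma Mpoint_slack T : (0 < m)%N -> saturated T ->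
  balanced (Mpoint R A T) /\
  forall d, d \in T -> diag_slack (Mpoint R A T) d = 0.
Proof.
move=> m0 sT; have [_ [x [bx Tx]]] := saturated_solution m0 sT.
suff <- : x = Mpoint R A T by [].
apply/rowP => i.
have [u [v [w [s [uv uw wv H]]]]] := coordinate_edge_slack i sT.
by rewrite (H x bx) !(edge_slack_edge bx Tx) // !subr0 mulr0 addr0.
Qed.
End Functionals.

(** * Central symmetry *)

Local Open Scope nat_scope.

Section Symmetric.
Variables (n : nat) (A : rel nat).
Hypotheses (n_gt0 : 1 <= n) (oA : is_orientation (2 * n - 1) A)
  (sA : symmetric_orientation n A).
Notation m := (2 * n).
Notation U := (up m A).
Notation lab := (@label m A).
Notation vtx := (vertex m A).
Implicit Types (a b c i j k : nat) (u v w t : 'I_m.+2).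

Lemma up_reflect i : 1 < i < m -> U (m.+1 - i) = ~~ U i.
Proof.
move=> im; have E : A i.-1 i = A (m.+1 - i) (m.+1 - i).-1.
  have := sA (i := i.-1); rewrite prednK; last by lia.
  have -> : m - i.-1 = m.+1 - i by lia.
  have -> : m.+1 - i - 1 = (m.+1 - i).-1 by lia.
  by apply; lia.
have pe : path_edge (2 * n - 1) i.-1 i by rewrite /path_edge; lia.
have := oA.2 _ _ pe; rewrite E /up => ->.
have -> : 2 <= m.+1 - i <= m.-1 by lia.
by have -> : 2 <= i <= m.-1 by lia.
Qed.

(* Antipodal vertices carry labels with sum [m + 1], except that [0] is opposite
to [m] and [1] to [m + 1]. *)
Definition opposite a : nat :=
  if a < 2 then m + a else if m <= a then a - m else m.+1 - a.

Lemma opposite_lt a : a < m.+2 -> opposite a < m.+2.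
Proof. by rewrite /opposite; case: (ltnP a 2); case: (leqP m a); lia. Qed.

Lemma oppositeK a : a < m.+2 -> opposite (opposite a) = a.
Proof.
by rewrite /opposite; case: (ltnP a 2); case: (leqP m a);
  do 2?[case: ifP]; lia.
Qed.

Lemma up_opposite a : a < m.+2 -> U (opposite a) = (1 < a < m) && ~~ U a.
Proof.
move=> am; rewrite /opposite; have Ub b := @up_bounds m A b.
case: (ltnP a 2) => h1; first by apply/negP => /Ub; lia.
case: (leqP m a) => h2; first by apply/negP => /Ub; lia.
by rewrite up_reflect ?h1.
Qed.

Lemma labels_opposite :
  let inner := [seq i <- iota 2 (m - 2) | ~~ U i] in
  labels m A = (0 :: 1 :: inner) ++ map opposite (0 :: 1 :: inner).
Proof.
move=> inner; have Ub b := @up_bounds m A b.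
have U1 : U 1 = false by apply/negP => /Ub; lia.
have Um : U m = false by apply/negP => /Ub; lia.
have iotaE : iota 1 m = 1 :: rcons (iota 2 (m - 2)) m.
  have -> : iota 1 m = iota 1 (1 + (m - 2 + 1)) by congr iota; lia.
  by rewrite !iotaD -cats1; congr (_ :: _ ++ [:: _]); lia.
rewrite /labels iotaE /= !filter_rcons Um /= -/inner -cats1 -catA /=.
have -> : opposite 0 = m by rewrite /opposite addn0.
have -> : opposite 1 = m.+1 by rewrite /opposite addn1.
suff -> : rev [seq i <- iota 2 (m - 2) | U i] = map opposite inner by [].
rewrite -filter_rev.
have -> : rev (iota 2 (m - 2)) = map opposite (iota 2 (m - 2)).
  apply: (@eq_from_nth _ 0) => [|k]; rewrite size_rev ?size_map //.
  rewrite size_iota => km; rewrite nth_rev ?size_iota // (nth_map 0) ?size_iota //.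
  rewrite !nth_iota; try lia.
  by rewrite /opposite; do 2?[case: ifP]; lia.
rewrite filter_map; congr map; apply: eq_in_filter => i.
rewrite mem_iota => im /=; rewrite up_opposite; last by lia.
by have -> : 1 < i < m by lia.
Qed.

Lemma label_antipode v : lab (antipode v) = opposite (lab v).
Proof.
have E := labels_opposite; cbv zeta in E.
set X := (0 :: 1 :: _) in E.
have sX : size X = n.+1.
  by have := size_labels m A; rewrite E size_cat size_map; lia.
have H w : w < n.+1 -> lab (antipode w) = opposite (lab w).
  move=> wn; rewrite /label val_antipode wn E !nth_cat sX wn.
  by rewrite ifF; [rewrite addnK (nth_map 0) // sX | lia].
have [vn|vn] := ltnP v n.+1; first exact: H.
have aw : antipode v < n.+1.
  by rewrite val_antipode; have := ltn_ord v; case: (ltnP v n.+1); lia.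
by rewrite -{2}(antipodeK v) (H _ aw) oppositeK ?lab_lt.
Qed.

Lemma boundary_01 : boundary_edge (vtx 0) (vtx 1).
Proof.
rewrite boundary_edgeE !val_vertex // pos0 /pos labels_opposite.
by [].
Qed.

Lemma boundary_mm1 : boundary_edge (vtx m) (vtx m.+1).
Proof.
have := boundary_01.
have opp a : a < m.+2 -> antipode (vtx a) = vtx (opposite a).
  by move=> am; rewrite -(vertex_lab A (antipode _)) label_antipode lab_vertex.
rewrite !boundary_edgeE => h.
have := congr1 (@nat_of_ord _) (opp 0 isT); have := congr1 (@nat_of_ord _) (opp 1 isT).
have -> : opposite 0 = m by rewrite /opposite addn0.
have -> : opposite 1 = m.+1 by rewrite /opposite addn1.
move=> <- <-; rewrite !val_antipode.
have p0 : vtx 0 = 0 :> nat by rewrite val_vertex // pos0.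
have := ltn_ord (vtx 1).
by move: h; rewrite p0; case: (ltnP 0 n.+1); case: (ltnP (vtx 1) n.+1); lia.
Qed.

Lemma opposite_anti a b : a < b < m.+2 -> ~~ boundary_edge (vtx a) (vtx b) ->
  opposite b < opposite a.
Proof.
move=> ab nb; have b0 : (a == 0) && (b == 1) = false.
  by apply/negP => /andP[/eqP Ea /eqP Eb]; move: nb; rewrite Ea Eb boundary_01.
have b1 : (a == m) && (b == m.+1) = false.
  by apply/negP => /andP[/eqP Ea /eqP Eb]; move: nb; rewrite Ea Eb boundary_mm1.
move: b0 b1; rewrite /opposite.
by case: (ltnP a 2); case: (ltnP b 2); case: (leqP m a); case: (leqP m b); lia.
Qed.

Lemma below_opposite a b k : a < b < m.+2 -> opposite b < opposite a ->
  0 < k <= m ->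
  below m A (opposite b) (opposite a) (m.+1 - k) = ~~ below m A a b k.
Proof.
move=> /andP[ab bm] ba k1; have am := ltn_trans ab bm.
have Ub c := @up_bounds m A c.
have Uk : U (m.+1 - k) = (1 < k < m) && ~~ U k.
  have [h|h] := boolP (1 < k < m); first exact: up_reflect.
  by apply/negP => /Ub; lia.
rewrite /below !up_opposite // Uk.
move: ba (Ub a) (Ub b) (Ub k); rewrite /opposite.
case: (boolP (1 < k < m)) => hk; case: (U a); case: (U b); case: (U k) => /=;
case: (ltnP a 2); case: (ltnP b 2); case: (leqP m a); case: (leqP m b); lia.
Qed.
End Symmetric.

(** * The face lattice *)

Local Open Scope classical_set_scope.
Local Open Scope ring_scope.

Section ConvexHull.
Variables (R : realType) (m : nat).
Implicit Types (c x y : 'rV[R]_m) (X : set 'rV[R]_m).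

Lemma convex_preimage_dot c (Q : R -> Prop) :
  (forall (l s t : R), 0 <= l -> l <= 1 -> Q s -> Q t -> Q (l * s + (1 - l) * t)) ->
  convex_set [set x : 'rV[R]_m | Q ((c *m x^T) 0 0)].
Proof.
move=> Qc x y l; rewrite !in_setE /= => Qx Qy.
have -> : conv l x y = l%:num *: (x : 'rV[R]_m) + (1 - l%:num) *: (y : 'rV[R]_m) by [].
rewrite linearD !linearZ /= mulmxDr -!scalemxAr mxE [X in X + _]mxE [X in _ + X]mxE.
by apply: Qc.
Qed.

Lemma conv_hull_le c b X : (forall x, X x -> (c *m x^T) 0 0 <= b) ->
  forall x, conv_hull X x -> (c *m x^T) 0 0 <= b.
Proof.
move=> XQ x hx; apply: (hx [set y : 'rV[R]_m | (c *m y^T) 0 0 <= b]); split=> //.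
by apply: (@convex_preimage_dot c (fun s => s <= b)) => l s t *; nra.
Qed.

Lemma conv_hull_lt c b X : (forall x, X x -> (c *m x^T) 0 0 < b) ->
  forall x, conv_hull X x -> (c *m x^T) 0 0 < b.
Proof.
move=> XQ x hx; apply: (hx [set y : 'rV[R]_m | (c *m y^T) 0 0 < b]); split=> //.
apply: (@convex_preimage_dot c (fun s => s < b)) => l s t l0 l1 sb tb.
have [->|lN0] := eqVneq l 0; first by rewrite mul0r subr0 mul1r add0r.
have : 0 < l * (b - s) by rewrite mulr_gt0 ?subr_gt0 // lt_def lN0.
have : 0 <= (1 - l) * (b - t) by rewrite mulr_ge0 ?subr_ge0 // ltW.
by lra.
Qed.

Lemma conv_hull_eq c b X : (forall x, X x -> (c *m x^T) 0 0 = b) ->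
  forall x, conv_hull X x -> (c *m x^T) 0 0 = b.
Proof.
move=> XQ x hx; apply: (hx [set y : 'rV[R]_m | (c *m y^T) 0 0 = b]); split=> //.
apply: (@convex_preimage_dot c (fun s => s = b)) => l s t _ _ -> ->.
by rewrite -mulrDl addrC subrK mul1r.
Qed.

Lemma sub_conv_hull X : X `<=` conv_hull X.
Proof. by move=> x Xx C /= [_]; apply. Qed.
End ConvexHull.

Section Slacks.
Variables (R : realType) (m : nat) (A : rel nat).
Notation diag_slack := (@diag_slack R m A).
Notation edge_slack := (@edge_slack R m A).
Implicit Types (T : {set {set 'I_m.+2}}) (x c : 'rV[R]_m).

Definition slack_combination T (g : 'rV[R]_m -> R) : Prop :=
  exists k (l : {set 'I_m.+2} -> R), forall x, balanced x ->
    g x = k + \sum_(d in T) l d * diag_slack x d.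

Lemma slack_combination_cst T k : slack_combination T (fun=> k).
Proof.
exists k, (fun=> 0) => x _; rewrite big1 ?addr0 // => d _; exact: mul0r.
Qed.

Lemma slack_combinationD T g h s : slack_combination T g -> slack_combination T h ->
  slack_combination T (fun x => g x + s * h x).
Proof.
move=> [k [l gE]] [k' [l' hE]]; exists (k + s * k'), (fun d => l d + s * l' d).
move=> x bx; rewrite gE // hE // mulrDr mulr_sumr addrACA -big_split /=.
by congr (_ + _); apply: eq_bigr => d _; rewrite mulrDl mulrA.
Qed.

Lemma slack_combination_edge T u v : graph_edge T u v ->
  slack_combination T (fun x => edge_slack x u v).
Proof.
case/orP=> [uv|uvT].
  exists 0, (fun=> 0) => x bx; rewrite edge_slack_boundary // big1 ?addr0 //.
  by move=> d _; exact: mul0r.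
exists 0, (fun d => (d == [set u; v]%SET)%:R) => x bx.
rewrite (bigD1 _ uvT) /= eqxx mul1r diag_slackE big1 ?addr0 ?add0r //.
by move=> d /andP[_ /negPf ->]; exact: mul0r.
Qed.

Lemma slack_combination_dot T c : saturated T ->
  slack_combination T (fun x => (c *m x^T) 0 0).
Proof.
move=> sT.
have coord i : slack_combination T (fun x : 'rV[R]_m => x 0 i).
  have [u [v [w [s [uv uw wv E]]]]] := coordinate_edge_slack R A i sT.
  have := slack_combinationD s (slack_combination_cst T (Mpoint R A T 0 i))
    (slack_combinationD (-1) (slack_combinationD (-1) (slack_combination_edge uv)
      (slack_combination_edge uw)) (slack_combination_edge wv)).
  move=> [k [l H]]; exists k, l => x bx; rewrite -H // E //.
  by rewrite !mulN1r.
have : slack_combination T (fun x => \sum_(i <- index_enum 'I_m) c 0 i * x 0 i).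
  elim: (index_enum _) => [|i r IHr].
    have [k [l H]] := slack_combination_cst T 0.
    by exists k, l => x bx; rewrite big_nil -H.
  have [k [l H]] := slack_combinationD (c 0 i) IHr (coord i).
  by exists k, l => x bx; rewrite big_cons addrC -H.
by move=> [k [l H]]; exists k, l => x bx; rewrite dotE H.
Qed.

Lemma diag_slack_Mpoint_ge0 T d : (0 < m)%N -> saturated T -> is_diagonal d ->
  0 <= diag_slack (Mpoint R A T) d.
Proof.
move=> m0 sT /diagonalE[u [v [-> uv]]]; rewrite diag_slackE.
have [bM TM] := Mpoint_slack R A m0 sT.
exact: (edge_slack_ge0 sT bM TM uv).1.
Qed.

Lemma diag_slack_Mpoint_gt0 T d : (0 < m)%N -> saturated T -> is_diagonal d ->
  d \notin T -> 0 < diag_slack (Mpoint R A T) d.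
Proof.
move=> m0 sT dd; have [u [v [Ed uv]]] := diagonalE dd; subst d => dT.
rewrite diag_slackE; have [bM TM] := Mpoint_slack R A m0 sT.
apply: (edge_slack_ge0 sT bM TM uv).2.
by case/is_diagonalP: dd => _ nb; rewrite /graph_edge negb_or nb.
Qed.
End Slacks.

Section Symmetric.
Variables (R : realType) (n : nat) (A : rel nat).
Hypotheses (n_gt0 : (1 <= n)%N) (oA : is_orientation (2 * n - 1) A)
  (sA : symmetric_orientation n A).
Notation m := (2 * n)%N.
Notation diag_slack := (@diag_slack R m A).
Notation edge_slack := (@edge_slack R m A).
Notation ap := (@antipode n).
Notation aps d := (ap @: (d : {set 'I_m.+2}))%SET.
Implicit Types (T : {set {set 'I_m.+2}}) (x c : 'rV[R]_m).

Definition reflect_coord x : 'rV[R]_m := \row_i (m.+1%:R - x 0 (rev_ord i)).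

Lemma sum_rev_ord x : \sum_i x 0 (rev_ord i) = \sum_i x 0 i.
Proof. by rewrite [RHS](reindex_inj rev_ord_inj). Qed.

Lemma balanced_reflect x : balanced x -> balanced (reflect_coord x).
Proof.
rewrite /balanced => bx.
rewrite (eq_bigr (fun i => m.+1%:R - x 0 (rev_ord i))); last by move=> i _; rewrite mxE.
rewrite sumrB sumr_const card_ord.
rewrite sum_rev_ord bx.
rewrite binomial2R -mulr_natr -[m.+1%:R]natr1; lra.
Qed.

Lemma slack_opposite x a b : balanced x -> (a < b < m.+2)%N ->
  (opposite n b < opposite n a)%N ->
  slack A x (opposite n b) (opposite n a) = slack A (reflect_coord x) a b.
Proof.
move=> bx ab ba; have /andP[_ bm] := ab.
have bam : (opposite n b < opposite n a < m.+2)%N.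
  by rewrite ba opposite_lt //; case/andP: ab => ab' _; exact: ltn_trans ab' _.
have K (i : 'I_m) : below m A (opposite n b) (opposite n a) (rev_ord i).+1 =
    ~~ below m A a b i.+1.
  have -> : (rev_ord i).+1 = (m.+1 - i.+1)%N by rewrite /=; have := ltn_ord i; lia.
  by apply: below_opposite => //; rewrite /= ltn_ord.
have sum_below_ab : \sum_(i < m) (below m A a b i.+1)%:R = (width m A a b)%:R - 1 :> R.
  by rewrite (sum_below A ab) -natr1 addrK natr_sum.
have sum_below_opp : (width m A (opposite n b) (opposite n a))%:R =
    m.+2%:R - (width m A a b)%:R :> R.
  rewrite (sum_below A bam) -natr1 natr_sum (reindex_inj rev_ord_inj) /=.
  rewrite (eq_bigr (fun i : 'I_m => 1 - (below m A a b i.+1)%:R)); last first.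
    by move=> i _; rewrite K; case: (below _ _ _ _ _); rewrite ?subrr ?subr0.
  rewrite sumrB sumr_const card_ord sum_below_ab -[m.+2%:R]natr1 -[m.+1%:R]natr1; lra.
rewrite /slack !dotE !binomial2R sum_below_opp.
rewrite (reindex_inj rev_ord_inj) /=.
have -> : \sum_(i < m) @below_row R m A (opposite n b) (opposite n a) 0 (rev_ord i)
      * x 0 (rev_ord i)
  = \sum_i x 0 i - \sum_(i < m) (below m A a b i.+1)%:R * x 0 (rev_ord i).
  rewrite -sum_rev_ord -sumrB.
  apply: eq_bigr => i _; rewrite mxE K.
  by case: (below _ _ _ _ _); rewrite ?mul1r ?mul0r ?subrr ?subr0.
have -> : \sum_(i < m) @below_row R m A a b 0 i * reflect_coord x 0 i
  = m.+1%:R * ((width m A a b)%:R - 1)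
    - \sum_(i < m) (below m A a b i.+1)%:R * x 0 (rev_ord i).
  rewrite -sum_below_ab mulr_sumr -sumrB; apply: eq_bigr => i _.
  by rewrite !mxE mulrBr mulrC.
rewrite bx binomial2R -[m.+2%:R]natr1 -[m.+1%:R]natr1; lra.
Qed.

Lemma edge_slack_antipode x u v : balanced x -> u != v -> ~~ boundary_edge u v ->
  edge_slack x (ap u) (ap v) = edge_slack (reflect_coord x) u v.
Proof.
move=> bx; rewrite -(vertex_lab A u) -(vertex_lab A v).
have E a : (a < m.+2)%N -> ap (vertex m A a) = vertex m A (opposite n a).
  move=> am; rewrite -(vertex_lab A (ap _)) label_antipode // lab_vertex //.
move: (lab_lt A u) (lab_lt A v); move: (label A u) (label A v) => a b am bm.
wlog ab : a b am bm / (a < b)%N.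
  move=> H ne nb; have [ab|ba|ab] := ltngtP a b.
  - exact: H.
  - by rewrite edge_slackC [RHS]edge_slackC H // 1?eq_sym 1?boundary_edgeC.
  - by rewrite ab eqxx in ne.
move=> _ nb; rewrite !E //.
have abm : (a < b < m.+2)%N by rewrite ab.
have ba := opposite_anti n_gt0 oA sA abm nb.
rewrite edge_slackC !edge_slack_vertex ?ba ?opposite_lt //.
exact: slack_opposite.
Qed.

Lemma diag_slack_antipode x d : balanced x -> is_diagonal d ->
  diag_slack x (aps d) = diag_slack (reflect_coord x) d.
Proof.
move=> bx dd; have [u [v [Ed uv]]] := diagonalE dd; subst d.
rewrite imset2_antipode !diag_slackE edge_slack_antipode //.
by case/is_diagonalP: dd.
Qed.

Lemma reflect_Mpoint T : saturated T -> centrally_symmetric T ->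
  reflect_coord (Mpoint R A T) = Mpoint R A T.
Proof.
have m0 : (0 < m)%N by lia.
move=> sT /centrally_symmetricP cT; have [bM TM] := Mpoint_slack R A m0 sT.
apply: (@edge_slack_inj R m A T _ _ sT (balanced_reflect bM) bM) => d dT.
rewrite -diag_slack_antipode ?TM ?cT //.
exact: noncrossing_diagonal sT.1 dT.
Qed.

Lemma diag_slack_Mpoint_antipode T d : saturated T -> centrally_symmetric T ->
  is_diagonal d -> diag_slack (Mpoint R A T) (aps d) = diag_slack (Mpoint R A T) d.
Proof.
move=> sT cT dd; have m0 : (0 < m)%N by lia.
have [bM _] := Mpoint_slack R A m0 sT.
by rewrite diag_slack_antipode // reflect_Mpoint.
Qed.

End Symmetric.

Lemma dotN (R : realType) m (c x : 'rV[R]_m) :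
  (- c *m x^T) 0 0 = - (c *m x^T) 0 0.
Proof. by rewrite mulNmx mxE. Qed.

Lemma dotB (R : realType) m (c c' x : 'rV[R]_m) :
  ((c - c') *m x^T) 0 0 = (c *m x^T) 0 0 - (c' *m x^T) 0 0.
Proof. by rewrite mulmxBl !mxE. Qed.

Section Cyclohedron.
Variables (R : realType) (n : nat) (A : rel nat).
Hypotheses (n_gt0 : (1 <= n)%N) (oA : is_orientation (2 * n - 1) A)
  (sA : symmetric_orientation n A).
Notation m := (2 * n)%N.
Notation diagset := {set 'I_m.+2}.
Notation diag_slack := (@diag_slack R m A).
Notation M := (@Mpoint R m A).
Notation aps d := (@antipode n @: (d : diagset))%SET.
Implicit Types (T D E : {set diagset}) (d e : diagset) (x c : 'rV[R]_m).

Definition cyclohedron : set 'rV[R]_m :=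
  conv_hull [set M T | T in [set T | is_cs_triangulation (n := n) T]].

Let P := cyclohedron.

Let m_gt0 : (0 < m)%N. Proof. by lia. Qed.

Lemma is_cs_triangulationP T :
  reflect (saturated T /\ centrally_symmetric T) (is_cs_triangulation T).
Proof.
apply: (iffP andP) => -[]; first by move/is_triangulation_saturated.
move=> sT cT; split=> //; have [cardT _] := saturated_solution R A m_gt0 sT.
by rewrite /is_triangulation cardT eqxx sT.1.
Qed.

Lemma Mpoint_in T : saturated T -> centrally_symmetric T -> P (M T).
Proof.
by move=> sT cT; apply: sub_conv_hull; exists T => //; apply/is_cs_triangulationP.
Qed.

Lemma P_balanced x : P x -> balanced x.
Proof.
move=> Px; have dot1 (y : 'rV[R]_m) : ((const_mx 1 : 'rV[R]_m) *m y^T) 0 0 = \sum_i y 0 i.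
  by rewrite dotE; apply: eq_bigr => i _; rewrite mxE mul1r.
rewrite /balanced -dot1; apply: conv_hull_eq Px => _ [T /is_cs_triangulationP[sT _] <-].
by rewrite dot1 (Mpoint_slack R A m_gt0 sT).1.
Qed.

Lemma P_slack_ge0 x d : is_diagonal d -> P x -> 0 <= diag_slack x d.
Proof.
move=> dd Px; rewrite diag_slack_dot subr_ge0 -lerN2 -dotN.
apply: conv_hull_le Px => _ [T /is_cs_triangulationP[sT _] <-].
by rewrite dotN lerN2 -subr_ge0 -diag_slack_dot diag_slack_Mpoint_ge0.
Qed.

Lemma P_slack_antipode x d : is_diagonal d -> P x ->
  diag_slack x (aps d) = diag_slack x d.
Proof.
move=> dd Px; rewrite !diag_slack_dot.
suff : (((diag_row R A (aps d) - diag_row R A d) *m x^T) 0 0 =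
   diag_const R A (aps d) - diag_const R A d) by rewrite dotB; lra.
apply: conv_hull_eq Px => _ [T /is_cs_triangulationP[sT cT] <-].
have := diag_slack_Mpoint_antipode R n_gt0 oA sA sT cT dd.
by rewrite !diag_slack_dot dotB; lra.
Qed.

Definition face_of (D : {set diagset}) : set 'rV[R]_m :=
  P `&` [set x | \sum_(d in D) diag_slack x d = 0].

Lemma face_ofP D x : noncrossing D ->
  face_of D x <-> P x /\ forall d, d \in D -> diag_slack x d = 0.
Proof.
move=> nD; split=> -[Px Dx]; split=> //; last by rewrite /= big1.
by apply: (psumr_eq0P _ Dx) => d dD; apply: P_slack_ge0 (noncrossing_diagonal nD dD) Px.
Qed.

Lemma face_of_Mpoint D T : noncrossing D -> saturated T -> centrally_symmetric T ->
  face_of D (M T) <-> D \subset T.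
Proof.
move=> nD sT cT; have dD d : d \in D -> is_diagonal d := noncrossing_diagonal nD.
rewrite face_ofP //; split=> [[_ Dx]|/fintype.subsetP DT]; last first.
  split; first exact: Mpoint_in.
  by move=> d /DT dT; apply: (Mpoint_slack R A m_gt0 sT).2.
apply/fintype.subsetP => d dD'; apply/negPn/negP => dT.
by have := diag_slack_Mpoint_gt0 R A m_gt0 sT (dD d dD') dT; rewrite Dx // ltxx.
Qed.

Lemma face_of_is_face D : noncrossing D -> is_face P (face_of D).
Proof.
move=> nD; have dD d : d \in D -> is_diagonal d := noncrossing_diagonal nD.
exists (- \sum_(d in D) diag_row R A d), (- \sum_(d in D) diag_const R A d).
have sumE x : ((- \sum_(d in D) diag_row R A d) *m x^T) 0 0 =
    - \sum_(d in D) diag_const R A d - \sum_(d in D) diag_slack x d.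
  rewrite dotN; under [X in _ = _ - X]eq_bigr do rewrite diag_slack_dot.
  rewrite sumrB opprB addKr mulmx_suml; congr (- _).
  by rewrite summxE.
split=> [x Px|].
  by rewrite sumE gerBl sumr_ge0 // => d /dD dd; exact: P_slack_ge0.
apply/seteqP; split=> x [Px /= Dx]; split=> //=; first by rewrite sumE Dx subr0.
by move: Dx; rewrite sumE => /eqP; rewrite subr_eq addrC -subr_eq subrr => /eqP.
Qed.

Lemma is_face_face_of F : is_face P F -> F !=set0 ->
  exists D, [/\ noncrossing D, centrally_symmetric D & face_of D = F].
Proof.
move=> [c [b [cP ->]]] [x0 [Px0 /= x0b]].
have [T [sT cT Tb]] : exists T, [/\ saturated T, centrally_symmetric T &
    (c *m (M T)^T) 0 0 = b].
  apply: contrapT => noT; suff : (c *m x0^T) 0 0 < b by rewrite x0b ltxx.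
  apply: conv_hull_lt Px0 => _ [T /is_cs_triangulationP[sT cT] <-].
  rewrite lt_neqAle cP ?andbT; last exact: Mpoint_in.
  by apply/eqP => Tb; apply: noT; exists T.
have nT := sT.1; have csT := centrally_symmetricP _ cT.
have dT d : d \in T -> is_diagonal d := noncrossing_diagonal nT.
have [k [l cE]] := slack_combination_dot A c sT.
have kb : k = b.
  have [bM TM] := Mpoint_slack R A m_gt0 sT.
  by rewrite -Tb cE // big1 ?addr0 // => d /TM ->; rewrite mulr0.
subst k.
pose nu d := - (l d + l (aps d)) / 2.
have nu_aps d : nu (aps d) = nu d by rewrite /nu antipode_setK [l _ + _]addrC.
have cE' x : P x -> (c *m x^T) 0 0 = b - \sum_(d in T) nu d * diag_slack x d.
  move=> Px; rewrite cE; last exact: P_balanced.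
  have S : \sum_(d in T) l d * diag_slack x d =
      \sum_(d in T) l (aps d) * diag_slack x d.
    rewrite (reindex_inj (inv_inj (@antipode_setK n))) /=.
    apply: eq_big => [d|d dT'].
      by apply/idP/idP => /csT //; rewrite antipode_setK.
    rewrite P_slack_antipode //; apply: dT.
    by have := csT _ dT'; rewrite antipode_setK.
  have -> : \sum_(d in T) nu d * diag_slack x d =
      - ((\sum_(d in T) l d * diag_slack x d
          + \sum_(d in T) l (aps d) * diag_slack x d) / 2).
    rewrite -big_split mulr_suml -sumrN; apply: eq_bigr => d _ /=.
    by rewrite /nu; lra.
  by rewrite -S; lra.
have nu_ge0 d : d \in T -> 0 <= nu d.
  move=> dT'; rewrite leNgt; apply/negP => nu_lt0.
  have [T' [sT' cT' ndT' TT']] := cs_flip sT cT dT'.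
  have PT' := Mpoint_in sT' cT'.
  have [_ TM'] := Mpoint_slack R A m_gt0 sT'.
  have := cP _ PT'; rewrite cE' // gerBl leNgt => /negP; apply.
  rewrite (bigD1 d) //= -oppr_gt0 opprD ltr_wpDr //.
    rewrite -sumrN sumr_ge0 // => e /andP[eT ed]; rewrite oppr_ge0.
    have [->|ed'] := eqVneq e (aps d); last by rewrite TM' ?mulr0 // TT'.
    rewrite nu_aps nmulr_rle0 //; apply: P_slack_ge0 => //.
    exact: is_diagonal_antipode (dT d dT').
  rewrite oppr_gt0 nmulr_rlt0 //.
  exact: diag_slack_Mpoint_gt0 (dT d dT') ndT'.
pose D := [set d in T | 0 < nu d]%SET.
have DT d : d \in D -> d \in T by rewrite inE => /andP[].
have nD : noncrossing D.
  apply/andP; split; apply/forall_inP=> d /DT dT'; first exact: dT.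
  by apply/forall_inP=> e /DT eT; exact: noncrossing_cross eT.
exists D; split=> //.
  apply/centrally_symmetricP => d; rewrite !inE => /andP[dT' nd].
  by rewrite nu_aps nd csT.
apply/seteqP; split=> x.
  move=> /(face_ofP _ nD)[Px Dx].
  split=> //=; rewrite cE' // big1 ?subr0 // => d dT'.
  have [nd|nd] := ltP 0 (nu d); first by rewrite Dx ?mulr0 // inE dT' nd.
  by have /eqP -> : nu d == 0; rewrite ?mul0r // eq_le nd nu_ge0.
move=> [Px /= xb]; apply/(face_ofP _ nD); split=> // d; rewrite inE => /andP[dT' nd].
have S0 : \sum_(d in T) nu d * diag_slack x d = 0 by move: xb; rewrite cE' //; lra.
have term_ge0 e (eT : e \in T) :=
  mulr_ge0 (nu_ge0 e eT) (P_slack_ge0 (dT e eT) Px).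
have /eqP := psumr_eq0P term_ge0 S0 dT'.
by rewrite mulf_eq0 gt_eqF //= => /eqP.
Qed.

Lemma face_of_subset D E : noncrossing D -> centrally_symmetric D ->
  noncrossing E -> face_of D `<=` face_of E <-> E \subset D.
Proof.
move=> nD cD nE; split=> [DE|/fintype.subsetP ED x]; last first.
  move=> /(face_ofP _ nD)[Px Dx]; apply/(face_ofP _ nE).
  by split=> // d /ED; exact: Dx.
apply/fintype.subsetP => e eE; apply/negPn/negP => eD.
suff [T [sT cT DT eT]] : exists T, [/\ saturated T, centrally_symmetric T,
    D \subset T & e \notin T].
  have /DE : face_of D (M T) by apply/face_of_Mpoint.
  by move/(face_of_Mpoint nE sT cT)/fintype.subsetP/(_ e eE); apply/negP.
have [T [DT sT cT]] := cs_extend nD cD.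
have [eT|eT] := boolP (e \in T); last by exists T.
have [T' [sT' cT' eT' TT']] := cs_flip sT cT eT.
exists T'; split=> //; apply/fintype.subsetP => d dD.
apply: TT'; first exact: (fintype.subsetP DT).
  by apply: contraNneq eD => <-.
apply: contraNneq eD => Ed; have /centrally_symmetricP/(_ _ dD) := cD.
by rewrite Ed antipode_setK.
Qed.

Lemma cyclohedron_realized : realizes_cyclohedron n P.
Proof.
split.
  exists [seq M T | T <- enum [pred T | is_cs_triangulation (n := n) T]].
  congr conv_hull; apply/seteqP; split=> x /=.
    by move=> [T csT <-]; apply/mapP; exists T; rewrite // mem_enum.
  by move=> /mapP[T]; rewrite mem_enum => csT ->; exists T.
have face_ne D : noncrossing D -> centrally_symmetric D -> face_of D !=set0.
  move=> nD cD; have [T [DT sT cT]] := cs_extend nD cD.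
  by exists (M T); apply/face_of_Mpoint.
exists (fun o => if o is Some D then face_of D else set0); split.
- case=> [D /andP[nD _]|_]; first exact: face_of_is_face.
  exists 0, 1; have dot0 x : (0 *m x^T : 'M[R]_1) 0 0 = 0 by rewrite mul0mx mxE.
  split=> [x _|]; first by rewrite dot0.
  by apply/seteqP; split=> // x [_ /=]; rewrite dot0 => /eqP; rewrite eq_sym oner_eq0.
- move=> F fF; have [->|/set0P F0] := eqVneq F set0; first by exists None.
  have [D [nD cD <-]] := is_face_face_of fF F0.
  by exists (Some D) => //=; rewrite nD.
case=> [D|] [E|] //=.
- by move=> /andP[nD cD] /andP[nE cE]; split=> /face_of_subset; apply.
- move=> /andP[nD cD] _; split=> // sub; have [x /sub] := face_ne D nD cD.
  by [].
- by move=> _ _; split=> // _ x [].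
Qed.
End Cyclohedron.

Theorem theorem1p5 (R : realType) (n : nat) (A : rel nat) :
  (1 <= n)%N ->
  is_orientation (2 * n - 1) A ->
  symmetric_orientation n A ->
  realizes_cyclohedron n
    (conv_hull [set Mpoint R A T | T in [set T | is_cs_triangulation (n := n) T]]) /\
  (forall T : {set {set 'I_(2 * n).+2}}, is_cs_triangulation T ->
     forall i : 'I_(2 * n), Mpoint R A T 0 i \is a Num.int).
Proof.
move=> n_gt0 oA sA; split; first exact: cyclohedron_realized.
by move=> T _ i; rewrite mxE; case: ifP => _; rewrite ?rpredB ?rpred_nat.
Qed.
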